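(* Let $\alpha\in\mathbb{C}$ and $\Delta,\bar\Delta\in\mathbb{C}^*$. Consider extensions of conformal $\widetilde{\mathrm{SV}}$-modules $$0\to V(\alpha,0,\bar\Delta)\to E\to V(\alpha,0,\Delta)\to0,$$ realized as $E=\mathbb{C}[\partial]v_{\bar\Delta}\oplus\mathbb{C}[\partial]v_\Delta$ with $\mathbb{C}[\partial]v_{\bar\Delta}\cong V(\alpha,0,\bar\Delta)$ a submodule and $$L_\lambda v_\Delta=(\partial+\alpha+\Delta\lambda)v_\Delta+f(\partial,\lambda)v_{\bar\Delta},\ M_\lambda v_\Delta=g(\partial,\lambda)v_{\bar\Delta},\ N_\lambda v_\Delta=k(\partial,\lambda)v_{\bar\Delta},\ Y_\lambda v_\Delta=h(\partial,\lambda)v_{\bar\Delta},$$ with $f,g,h,k\in\mathbb{C}[\partial,\lambda]$. Nontrivial extensions of this form exist only if $\Delta-\bar\Delta\in\{0,1,2,3,4,5,6\}$. In these cases they are given, up to equivalence, as follows (with $\bar\partial=\partial+\alpha$), and always $g=h=0$: (i) $\Delta=\bar\Delta$: $f=c_0+c_1\lambda$, $k=a_0$, $(c_0,c_1,a_0)\neq(0,0,0)$; (ii) $\Delta-\bar\Delta=1$: $f=0$, $k=a_1\lambda$, $a_1\neq0$; (iii) $\Delta-\bar\Delta=2$: $f=c_2\lambda^2(2\bar\partial+\lambda)$, $k=a_2\lambda(\bar\partial-\bar\Delta\lambda)$, $(c_2,a_2)\neq(0,0)$; (iv) $(\Delta,\bar\Delta)=(1,-2)$: $f=c_3\bar\partial\lambda^2(\bar\partial+\lambda)$,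 $k=a_3\lambda(\bar\partial^2+3\bar\partial\lambda+2\lambda^2)$, $(c_3,a_3)\neq(0,0)$; (iv') $\Delta-\bar\Delta=3$, $\bar\Delta\neq-2$: $k=0$, $f=c_3\bar\partial\lambda^2(\bar\partial+\lambda)$, $c_3\neq0$; (v) $\Delta-\bar\Delta=4$: $k=0$, $f=c_5\lambda^2(4\bar\partial^3+6\bar\partial^2\lambda-\bar\partial\lambda^2+\bar\Delta\lambda^3)$, $c_5\neq0$; (vi) $(\Delta,\bar\Delta)=(1,-4)$: $k=0$, $f=c_6(\bar\partial^4\lambda^2-10\bar\partial^2\lambda^4-17\bar\partial\lambda^5-8\lambda^6)$, $c_6\neq0$; (vii) $(\Delta,\bar\Delta)=(\tfrac72\pm\tfrac{\sqrt{19}}2,-\tfrac52\pm\tfrac{\sqrt{19}}2)$: $k=0$, $f=c_7\big(\bar\partial^4\lambda^3-(2\bar\Delta+3)\bar\partial^3\lambda^4-3\bar\Delta\bar\partial^2\lambda^5-(3\bar\Delta+1)\bar\partial\lambda^6-(\bar\Delta+\tfrac9{28})\lambda^7\big)$, $c_7\neq0$.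
   Context: A conformal module over a Lie conformal algebra $R$ is a $\mathbb{C}[\partial]$-module $V$ with $a\mapsto a_\lambda\in\mathrm{End}_{\mathbb{C}}(V)\otimes\mathbb{C}[\lambda]$ satisfying $[a_\lambda,b_\mu]=[a_\lambda b]_{\lambda+\mu}$ and $(\partial a)_\lambda=[\partial,a_\lambda]=-\lambda a_\lambda$. $\widetilde{\mathrm{SV}}$ is the Lie conformal algebra that is the free $\mathbb{C}[\partial]$-module with basis $L,M,Y,N$ whose nonzero $\lambda$-brackets (up to skew-symmetry) are $[L_\lambda L]=(\partial+2\lambda)L$, $[L_\lambda Y]=(\partial+\tfrac32\lambda)Y$, $[L_\lambda M]=(\partial+\lambda)M$, $[Y_\lambda Y]=(\partial+2\lambda)M$, $[L_\lambda N]=(\partial+\lambda)N$, $[N_\lambda M]=2M$, $[N_\lambda Y]=Y$. $V(\alpha,\beta,\Delta)=\mathbb{C}[\partial]v_\Delta$ with $L_\lambda v_\Delta=(\partial+\alpha+\Delta\lambda)v_\Delta$, $N_\lambda v_\Delta=\beta v_\Delta$, $M_\lambda v_\Delta=Y_\lambda v_\Delta=0$. An extension of $W$ by $V$ is an exact sequence $0\to V\to E\to W\to0$ of conformal modules; equivalence via a module map of middle terms compatible with identities; trivial means equivalent to the direct sum. *)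

(* Defs.v *)
(* The complex numbers are modelled as R[i] = complex R for an
   arbitrary R : realType (every realType is a complete archimedean ordered
   field, i.e. a copy of the real numbers). *)
From mathcomp Require Import all_boot all_algebra.
From mathcomp Require Import reals complex.
Set Implicit Arguments. Unset Strict Implicit. Unset Printing Implicit Defensive.
Import GRing.Theory.
Local Open Scope ring_scope.

(* The Lie conformal algebra SV~ : free C[d]-module on L, M, Y, N.           *)
Inductive svgen := GL | GM | GY | GN.

(* The listed nonzero lambda-brackets [a_lambda b] = sum_c P_c(d, lambda) c,
   with P_c given as a function of (d, lambda). *)
Definition sv_listed_br (R : realType) (a b : svgen)
  : seq (svgen * (R[i] -> R[i] -> R[i])) :=
  match a, b with
  | GL, GL => [:: (GL, fun d l => d + 2%:R * l)]
  | GL, GY => [:: (GY, fun d l => d + (3%:R / 2%:R) * l)]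
  | GL, GM => [:: (GM, fun d l => d + l)]
  | GY, GY => [:: (GM, fun d l => d + 2%:R * l)]
  | GL, GN => [:: (GN, fun d l => d + l)]
  | GN, GM => [:: (GM, fun _ _ => 2%:R)]
  | GN, GY => [:: (GY, fun _ _ => 1)]
  | _, _ => [::]
  end.

(* All brackets: listed ones, the remaining ones by skew-symmetry
   [b_lambda a] = - [a_{-lambda-d} b]; pairs not obtained this way are 0. *)
Definition sv_br (R : realType) (a b : svgen)
  : seq (svgen * (R[i] -> R[i] -> R[i])) :=
  match sv_listed_br R a b with
  | [::] => [seq (c.1, fun d l => - c.2 d (- l - d)) | c <- sv_listed_br R b a]
  | s => s
  end.

(* The middle term E = C[d] vbar (+) C[d] v, an element (p, q) standing for   *)
(* p(d) vbar + q(d) v.  Polynomials in (d, lambda) are {poly {poly C}} with  *)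
(* the INNER variable d and the OUTER variable lambda.                       *)
Definition Emod (R : realType) := ({poly R[i]} * {poly R[i]})%type.

Record ext_data (R : realType) := ExtData {
  ext_f : {poly {poly R[i]}};  (* L_lambda v = (d+alpha+Delta lambda) v + f vbar *)
  ext_g : {poly {poly R[i]}};  (* M_lambda v = g vbar *)
  ext_h : {poly {poly R[i]}};  (* Y_lambda v = h vbar *)
  ext_k : {poly {poly R[i]}}   (* N_lambda v = k vbar *)
}.

Definition dshift (R : realType) (p : {poly R[i]}) (l : R[i]) : {poly R[i]} :=
  p \Po ('X + l%:P).

Definition lev (R : realType) (F : {poly {poly R[i]}}) (l : R[i]) : {poly R[i]} :=
  F.[l%:P].

(* The action X_lambda on E, at a numerical value lambda, extended from the
   generators vbar, v by the rule X_lambda (p(d) w) = p(d + lambda) X_lambda w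
   (i.e. [d, X_lambda] = - lambda X_lambda).  Here
     L_lambda vbar = (d + alpha + Dbar lambda) vbar,  N_lambda vbar = 0 vbar (beta = 0),
     M_lambda vbar = Y_lambda vbar = 0,
     L_lambda v = (d + alpha + Delta lambda) v + f vbar, M_lambda v = g vbar,
     N_lambda v = 0 v + k vbar (beta = 0),  Y_lambda v = h vbar. *)
Definition ext_act (R : realType) (alpha Delta Dbar : R[i]) (D : ext_data R)
    (X : svgen) (l : R[i]) (w : Emod R) : Emod R :=
  let p' := dshift w.1 l in
  let q' := dshift w.2 l in
  match X with
  | GL => (p' * ('X + (alpha + Dbar * l)%:P) + q' * lev (ext_f D) l,
           q' * ('X + (alpha + Delta * l)%:P))
  | GM => (q' * lev (ext_g D) l, 0)
  | GY => (q' * lev (ext_h D) l, 0)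
  | GN => (q' * lev (ext_k D) l, 0)
  end.

(* The conformal-module axiom [a_lambda, b_mu] = [a_lambda b]_{lambda+mu} for
   all generators a, b, where (P(d, lambda) c)_{nu} = P(-nu, lambda) c_nu.
   Polynomial identities in lambda, mu are imposed at all numerical values
   (equivalent, since C is infinite). *)
Definition is_conformal_ext (R : realType) (alpha Delta Dbar : R[i])
    (D : ext_data R) : Prop :=
  forall (a b : svgen) (l m : R[i]) (w : Emod R),
    ext_act alpha Delta Dbar D a l (ext_act alpha Delta Dbar D b m w)
    - ext_act alpha Delta Dbar D b m (ext_act alpha Delta Dbar D a l w)
    = \sum_(c <- sv_br R a b) (c.2 (- (l + m)) l) *: ext_act alpha Delta Dbar D c.1 (l + m) w.

Definition dmul (R : realType) (w : Emod R) : Emod R := ('X * w.1, 'X * w.2).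

Definition ext_equiv (R : realType) (alpha Delta Dbar : R[i])
    (D1 D2 : ext_data R) : Prop :=
  exists phi : Emod R -> Emod R,
    [/\ (forall w1 w2, phi (w1 + w2) = phi w1 + phi w2)
         /\ (forall (c : R[i]) w, phi (c *: w) = c *: phi w),
        (forall w, phi (dmul w) = dmul (phi w)),
        (forall X l w, phi (ext_act alpha Delta Dbar D1 X l w)
                       = ext_act alpha Delta Dbar D2 X l (phi w)),
        (forall p, phi (p, 0) = (p, 0)) &
        (forall w, (phi w).2 = w.2)].

(* the direct sum V(alpha,0,Dbar) (+) V(alpha,0,Delta) *)
Definition zero_data (R : realType) : ext_data R := ExtData 0 0 0 0.

Definition ext_trivial (R : realType) (alpha Delta Dbar : R[i]) (D : ext_data R) :=
  ext_equiv alpha Delta Dbar D (zero_data R).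

Definition lam (R : realType) : {poly {poly R[i]}} := 'X.
Definition dbar (R : realType) (alpha : R[i]) : {poly {poly R[i]}} := ('X + alpha%:P)%:P.
Definition cst (R : realType) (c : R[i]) : {poly {poly R[i]}} := c%:P%:P.

(* The list (i)-(vii) of the paper: (f, k) with g = h = 0. *)
Definition listed_ext (R : realType) (alpha Delta Dbar : R[i])
    (f k : {poly {poly R[i]}}) : Prop :=
  let l := lam R in let db := dbar alpha in
  (Delta = Dbar /\ exists c0 c1 a0 : R[i],
     (c0, c1, a0) != (0, 0, 0) /\ f = cst c0 + cst c1 * l /\ k = cst a0)
  \/ (Delta - Dbar = 1 /\ exists a1 : R[i], a1 != 0 /\ f = 0 /\ k = cst a1 * l)
  \/ (Delta - Dbar = 2%:R /\ exists c2 a2 : R[i], (c2, a2) != (0, 0) /\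
       f = cst c2 * l ^+ 2 * (cst 2%:R * db + l) /\
       k = cst a2 * l * (db - cst Dbar * l))
  \/ ((Delta = 1 /\ Dbar = - 2%:R) /\ exists c3 a3 : R[i], (c3, a3) != (0, 0) /\
       f = cst c3 * db * l ^+ 2 * (db + l) /\
       k = cst a3 * l * (db ^+ 2 + cst 3%:R * db * l + cst 2%:R * l ^+ 2))
  \/ ((Delta - Dbar = 3%:R /\ Dbar != - 2%:R) /\ exists c3 : R[i], c3 != 0 /\
       k = 0 /\ f = cst c3 * db * l ^+ 2 * (db + l))
  \/ (Delta - Dbar = 4%:R /\ exists c5 : R[i], c5 != 0 /\ k = 0 /\
       f = cst c5 * l ^+ 2 * (cst 4%:R * db ^+ 3 + cst 6%:R * db ^+ 2 * l
                              - db * l ^+ 2 + cst Dbar * l ^+ 3))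
  \/ ((Delta = 1 /\ Dbar = - 4%:R) /\ exists c6 : R[i], c6 != 0 /\ k = 0 /\
       f = cst c6 * (db ^+ 4 * l ^+ 2 - cst 10%:R * db ^+ 2 * l ^+ 4
                     - cst 17%:R * db * l ^+ 5 - cst 8%:R * l ^+ 6))
  \/ ((exists s : R[i], s ^+ 2 = 19%:R /\
         Delta = 7%:R / 2%:R + s / 2%:R /\ Dbar = - (5%:R / 2%:R) + s / 2%:R)
      /\ exists c7 : R[i], c7 != 0 /\ k = 0 /\
       f = cst c7 * (db ^+ 4 * l ^+ 3 - cst (2%:R * Dbar + 3%:R) * db ^+ 3 * l ^+ 4
                     - cst (3%:R * Dbar) * db ^+ 2 * l ^+ 5
                     - cst (3%:R * Dbar + 1) * db * l ^+ 6
                     - cst (Dbar + 9%:R / 28%:R) * l ^+ 7)).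

(* Main.v *)
(** An extension is described by a pair of polynomial 1-cocycles [f] (for [L]) and [k] (for [N]);
    the brackets [[N, M] = 2M] and [[N, Y] = Y] force [g = h = 0], and changing the splitting adds to
    [f] a coboundary and leaves [k] alone.  After the translation [d -> d - alpha] both cocycle
    equations become recursions between the coefficients of [d^r lambda^i].  The part of the equation
    linear in [mu] is an Euler identity: up to a coboundary, [f] is homogeneous of degree
    [n = Delta - Dbar + 1] and divisible by [lambda^2] (except for [Delta = Dbar]).  It is then
    determined by its coefficients at [lambda^2] and [lambda^3], the values on the generators [L_1],
    [L_2] of the positive part of the Witt algebra.  The two relations between these generators, in
    weights 5 and 7, say that a non-coboundary needs [(2 Dbar + n - 2)^2 = 3n - 2] if [n >= 6], and
    never exists if [n >= 8].  Likewise [k] is homogeneous of degree [Delta - Dbar] and determined by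
    its coefficient at [lambda]. *)
Require Import Defs.
From HB Require Import structures.
From mathcomp Require Import all_boot all_algebra.
From mathcomp Require Import polyXY ring zify.
From mathcomp Require Import boolp reals complex.
Import GRing.Theory Num.Theory.
Local Open Scope ring_scope.
Set Implicit Arguments. Unset Strict Implicit. Unset Printing Implicit Defensive.

(** * The shift [p(d) -> p(d + lambda)] and coboundaries *)

(** As a ring morphism the shift is accessible to [horner_map] and [coef_map], also under
    [map_poly]. *)
HB.instance Definition _ (A : comNzRingType) :=
  GRing.RMorphism.copy (@poly_XaY A) (comp_poly ('X + 'Y) \o map_poly polyC).

(** Taylor expansion in powers of [lambda], with divided derivatives as coefficients. *)
Lemma coef_poly_XaY (A : comNzRingType) (p : {poly A}) i r :
  (poly_XaY p)`_i`_r = p`_(r + i) *+ 'C(r + i, i).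
Proof.
rewrite /poly_XaY /comp_poly addrC nderiv_taylor; last exact: mulrC.
have sz : size (p^:P)^:P = size p by rewrite !size_map_polyC.
rewrite (eq_bigr (fun j : 'I__ => p^`N(j) *: 'X^j)); last first.
  move=> j _; rewrite !nderivn_map horner_map -mul_polyC; congr (_ %:P * _).
  by rewrite -[RHS](comp_polyXr).
rewrite sz -(poly_def (size p) (fun j => p^`N(j))) coef_poly.
case: ltnP => [_|le].
  by rewrite coef_nderivn addnC.
by rewrite coef0 nth_default ?mul0rn // (leq_trans le) // leq_addl.
Qed.

(* Locked, since otherwise rewriting with [coefB] and the like looks through it. *)
HB.lock Definition coboundary (K : comNzRingType) (al De x : K) (p : {poly K}) : {poly {poly K}} :=
  poly_XaY p * (('X + al%:P)%:P + x%:P%:P * 'X) - (('X + al%:P)%:P + De%:P%:P * 'X) * p%:P.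

(** * The cocycle equations, numerical and polynomial *)

Section Cocycles.
Variable K : numFieldType.
Implicit Types (al De x l m b c t : K) (F G k W : {poly {poly K}}) (p : {poly K}).

(** The [vbar]-component of [[L_l, L_m] v = (l - m) L_(l+m) v], with [De] for [Delta] and [x] for
    [Dbar]. *)
Definition L_cocycle al De x F := forall l m,
  ('X + (al + l + De * m)%:P) * F.[l%:P] + (F.[m%:P] \Po ('X + l%:P)) * ('X + (al + x * l)%:P)
  - (('X + (al + m + De * l)%:P) * F.[m%:P] + (F.[l%:P] \Po ('X + m%:P)) * ('X + (al + x * m)%:P))
  = (l - m)%:P * F.[(l + m)%:P].

(** The [vbar]-component of [[L_l, N_m] v = - m N_(l+m) v], where [N] kills [vbar]. *)
Definition N_cocycle al De x F := forall l m,
  (F.[m%:P] \Po ('X + l%:P)) * ('X + (al + x * l)%:P) - ('X + (al + m + De * l)%:P) * F.[m%:P]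
  = - (m%:P * F.[(l + m)%:P]).

Lemma poly_eq0_of_zeros (A : idomainType) (f : nat -> A) (p : {poly A}) :
  injective f -> (forall n, p.[f n] = 0) -> p = 0.
Proof.
move=> fI p0; apply: (@roots_geq_poly_eq0 _ p (map f (iota 0 (size p)))).
- by apply/allP => _ /mapP [n _ ->]; apply/rootP.
- by rewrite map_inj_uniq ?iota_uniq.
- by rewrite size_map size_iota.
Qed.

Lemma natr_inj : injective (fun n : nat => n%:R : K).
Proof. by move=> m n /eqP; rewrite eqr_nat => /eqP. Qed.

Lemma eq_poly_horner (F G : {poly {poly K}}) :
  (forall l, F.[l%:P] = G.[l%:P]) -> F = G.
Proof.
move=> FG; apply/eqP; rewrite -subr_eq0; apply/eqP.
apply: (@poly_eq0_of_zeros _ (fun n : nat => n%:R%:P)).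
  by move=> a b /polyC_inj /natr_inj.
by move=> n; rewrite hornerD hornerN FG subrr.
Qed.

Lemma eq_poly_horner2 (F G : {poly {poly {poly K}}}) :
  (forall l m, F.[m%:P, l%:P] = G.[m%:P, l%:P]) -> F = G.
Proof.
move=> FG; apply/eqP; rewrite -subr_eq0; apply/eqP.
apply: (@poly_eq0_of_zeros _ (fun n : nat => n%:R%:P%:P)).
  by move=> a b /polyC_inj /polyC_inj /natr_inj.
move=> n; rewrite hornerD hornerN; apply/eqP; rewrite subr_eq0; apply/eqP.
by apply: eq_poly_horner => l; apply: FG.
Qed.

Lemma horner_XaY p l : (poly_XaY p).[l%:P] = p \Po ('X + l%:P).
Proof. by rewrite horner_poly_XaY addrC. Qed.

Lemma horner_coboundary al De x p l :
  (coboundary al De x p).[l%:P] =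
  (p \Po ('X + l%:P)) * ('X + (al + x * l)%:P) - ('X + (al + De * l)%:P) * p.
Proof. by rewrite coboundary.unlock !hornerE horner_XaY; ring. Qed.

Lemma horner_map_XaY F l m :
  (map_poly (@poly_XaY K) F).[m%:P, l%:P] = F.[m%:P] \Po ('X + l%:P).
Proof.
have e : m%:P%:P = poly_XaY m%:P by rewrite /poly_XaY map_polyC comp_polyC.
by rewrite [_%:P%:P]e horner_map horner_XaY.
Qed.

(* In [{poly {poly {poly K}}}] below, ['X] is mu, ['X%:P] is lambda and ['X%:P%:P] is d. *)
Lemma L_cocycleP De x F : L_cocycle 0 De x F ->
  let H := ('X%:P%:P + 'X%:P + De%:P%:P%:P * 'X) * F%:P
           + map_poly (@poly_XaY K) F * ('X%:P%:P + x%:P%:P%:P * 'X%:P) in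
  H - swapXY H = ('X%:P - 'X) * poly_XaY F.
Proof.
move=> cF H; apply: eq_poly_horner2 => l m.
(* [H] comes from [L_l (L_m v)]; [swapXY] supplies the opposite order. *)
have e : forall l m, H.[m%:P, l%:P] =
    ('X + (l + De * m)%:P) * F.[l%:P] + (F.[m%:P] \Po ('X + l%:P)) * ('X + (x * l)%:P).
  by move=> {}l {}m; rewrite /H !hornerE horner_map_XaY; ring.
clearbody H; rewrite !(hornerD, hornerN) horner2_swapXY !e.
have := cF l m; rewrite !add0r => ->.
by rewrite !hornerE horner_poly_XaY horner_comp !hornerE (addrC m%:P) polyCB polyCD.
Qed.

Lemma N_cocycleP De x F : N_cocycle 0 De x F ->
  map_poly (@poly_XaY K) F * ('X%:P%:P + x%:P%:P%:P * 'X%:P)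
  - ('X%:P%:P + 'X + De%:P%:P%:P * 'X%:P) * F^:P = - ('X * poly_XaY F).
Proof.
move=> cF; apply: eq_poly_horner2 => l m.
have := cF l m; rewrite !add0r => e.
rewrite !hornerE horner_map_XaY.
rewrite horner_map horner_poly_XaY horner_comp !hornerE.
by rewrite (addrC m%:P) -polyCD -e; ring.
Qed.

(** * Recursions between the coefficients of a cocycle *)

Lemma coefXaY_map F i j r :
  (map_poly (@poly_XaY K) F)`_j`_i`_r = F`_j`_(r + i) *+ 'C(r + i, i).
Proof. by rewrite coef_map coef_poly_XaY. Qed.

(* The coefficient of [d^r lambda^(i+1)] in [(d + lambda)^(r+i) (d + x lambda)]. *)
Definition cob_coef x r i : K := 'C(r + i, i.+1)%:R + x * 'C(r + i, i)%:R.

Lemma cob_coef_i0 x r : cob_coef x r 0 = r%:R + x.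
Proof. by rewrite /cob_coef addn0 bin1 bin0 mulr1. Qed.

Lemma cob_coef_r0 x i : cob_coef x 0 i.+1 = x.
Proof. by rewrite /cob_coef binn bin_small // add0r mulr1. Qed.

Lemma coef_map_XaY_mul x F i j r :
  (map_poly (@poly_XaY K) F * ('X%:P%:P + x%:P%:P%:P * 'X%:P))`_j`_i.+1`_r
  = cob_coef x r i * F`_j`_(r + i).
Proof.
have -> : 'X%:P%:P + x%:P%:P%:P * 'X%:P = ('X%:P + x%:P%:P * 'X)%:P :> {poly {poly {poly K}}}.
  by rewrite polyCD polyCM.
rewrite coefMC mulrDr mulrCA !coefD coefMC coefCM coefMX coefMX coefCM /= !coefXaY_map /cob_coef.
case: r => [|r] /=; first by rewrite !add0n (bin_small (ltnSn i)) binn !add0r !mulr1.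
rewrite !addSnnS -[_ *+ _]mulr_natr -[_ *+ 'C(_, i)]mulr_natr; ring.
Qed.

(** Compares coefficients of [d^r lambda^(i+1) mu^(j+1)]. The factor [d + lambda + De mu] has degree
    1 in [mu], so [De] enters only for [j = 0] and, by symmetry, for [i = 0]. *)
Lemma L_coef De x F : L_cocycle 0 De x F -> forall i j r,
  De * ((j == 0)%:R * F`_i.+1`_r - (i == 0)%:R * F`_j.+1`_r)
  + cob_coef x r i * F`_j.+1`_(r + i) - cob_coef x r j * F`_i.+1`_(r + j)
  = ('C(i + j.+1, i)%:R - 'C(i + j.+1, i.+1)%:R) * F`_(i + j).+1`_r.
Proof.
move=> /L_cocycleP /= E i j r.
set H := (X in X - _) in E.
have e i' j' : H`_j'.+1`_i'.+1`_r
    = De * ((j' == 0)%:R * F`_i'.+1`_r) + cob_coef x r i' * F`_j'.+1`_(r + i').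
  rewrite /H 3!coefD coef_map_XaY_mul; congr (_ + _).
  rewrite coefMC !coefD !coefC coefCM coefX /= !add0r.
  rewrite eqSS; case: (j' == 0).
    by rewrite mulr1 mul1r coefCM coefCM.
  by rewrite mulr0 !mul0r mulr0 !coef0.
have := congr1 (fun P : {poly {poly {poly K}}} => P`_j.+1`_i.+1`_r) E.
rewrite !coefB coef_swapXY !e.
rewrite mulrBl !coefB coefCM !coefXM /= !coef_poly_XaY !coefMn.
have -> : 'C(i + j.+1, j.+1) = 'C(i + j.+1, i) by rewrite -bin_sub ?leq_addl // addnK.
have -> : 'C(i.+1 + j, j) = 'C(i + j.+1, i.+1).
  by rewrite -bin_sub ?leq_addl // addnK addSnnS.
rewrite addSnnS addnS -[F`__`__ *+ 'C(_, i)]mulr_natl -[F`__`__ *+ 'C(_, i.+1)]mulr_natl => e1.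
by rewrite [RHS]mulrBl -e1; ring.
Qed.

Lemma coef_coboundaryS De x p i r :
  (coboundary 0 De x p)`_i.+1`_r = cob_coef x r i * p`_(r + i) - (i == 0)%:R * De * p`_r.
Proof.
rewrite coboundary.unlock !addr0 !coefB; congr (_ - _).
  rewrite mulrDr mulrCA !coefD coefMC coefCM coefMX coefMX coefCM /= !coef_poly_XaY /cob_coef.
  case: r => [|r] /=; first by rewrite !add0n (bin_small (ltnSn i)) binn !add0r !mulr1.
  rewrite !addSnnS -[_ *+ _]mulr_natr -[_ *+ 'C(_, i)]mulr_natr; ring.
rewrite coefMC coefD coefC coefCM coefX /= add0r eqSS.
case: (i == 0); last by rewrite mulr0 !mul0r coef0.
by rewrite mulr1 mul1r coefCM.
Qed.

Lemma coef_coboundary0 De x p : (coboundary 0 De x p)`_0 = 0.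
Proof.
rewrite -horner_coef0 (horner_coboundary 0 De x p 0) !mulr0 !addr0 comp_polyXr; ring.
Qed.

(** At [mu = 0] the terms in [F(d, lambda)] cancel; what remains says that [F(d, 0)] has zero
    coboundary. *)
Lemma L_coef0 De x F : L_cocycle 0 De x F -> forall i r,
  cob_coef x r i * F`_0`_(r + i) = (i == 0)%:R * De * F`_0`_r.
Proof.
move=> cF i r; apply/eqP; rewrite -subr_eq0 -coef_coboundaryS; apply/eqP.
suff -> : coboundary 0 De x F`_0 = 0 by rewrite !coef0.
apply: eq_poly_horner => l; rewrite horner_coboundary horner0 -horner_coef0.
have := cF l 0; rewrite -[0%:P]/(0 : {poly K}) !mulr0 !addr0 !add0r subr0 comp_polyXr => e.
rewrite -[RHS](subrr (l%:P * F.[l%:P])) -{1}e; ring.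
Qed.

(** Compares coefficients of [d^r lambda^(i+1) mu^j]. *)
Lemma N_coef De x F : N_cocycle 0 De x F -> forall i j r,
  cob_coef x r i * F`_j`_(r + i) - (i == 0)%:R * De * F`_j`_r
  + 'C(i + j, i.+1)%:R * F`_(i + j)`_r = 0.
Proof.
move=> /N_cocycleP E i j r.
have := congr1 (fun P : {poly {poly {poly K}}} => P`_j`_i.+1`_r) E.
rewrite !coefB coef_map_XaY_mul.
have -> : ('X%:P%:P + 'X + De%:P%:P%:P * 'X%:P) * F^:P
    = ('X%:P + De%:P%:P * 'X)%:P * F^:P + 'X * F^:P.
  by rewrite polyCD polyCM; ring.
rewrite coefD coefCM coefXM !coef_map /= !coefD coefMC coefD coefC coefCM coefX /= add0r eqSS.
have -> : (if j == 0 then 0 else (F`_j.-1)%:P)`_i.+1 = 0 :> {poly K}.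
  by case: (j == 0); rewrite ?coef0 // coefC.
rewrite coef0 addr0 mulr_natr mulrnAl coefMn coefCM.
rewrite coefN coefN coefN coefXM => e.
have {}e : cob_coef x r i * F`_j`_(r + i) - De * F`_j`_r *+ (i == 0%N)
    = - ('C(i + j, i.+1)%:R * F`_(i + j)`_r).
  rewrite e; case: (j) => [|j'] /=; first by rewrite !coef0 addn0 bin_small // mul0r.
  rewrite coef_poly_XaY coefMn addSnnS mulr_natl -[in RHS]bin_sub; last first.
    by rewrite addnS ltnS leq_addr.
  by congr (- (_ *+ 'C(_, _))); rewrite addnS subSS addKn.
by rewrite -mulrA mulr_natl e addNr.
Qed.

(** * Differences, coboundaries and translations of cocycles *)

Lemma L_cocycle0 al De x : L_cocycle al De x 0.
Proof. by move=> l m; rewrite !horner0 !comp_poly0; ring. Qed.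

Lemma N_cocycle0 al De x : N_cocycle al De x 0.
Proof. by move=> l m; rewrite !horner0 comp_poly0; ring. Qed.

Lemma L_cocycleB al De x F G :
  L_cocycle al De x F -> L_cocycle al De x G -> L_cocycle al De x (F - G).
Proof.
move=> cF cG l m.
rewrite !(hornerD, hornerN, comp_polyB) [RHS]mulrBr -cF -cG; ring.
Qed.

Lemma N_cocycleB al De x F G :
  N_cocycle al De x F -> N_cocycle al De x G -> N_cocycle al De x (F - G).
Proof.
move=> cF cG l m.
rewrite !(hornerD, hornerN, comp_polyB) [in RHS]mulrBr opprB -[m%:P * G.[_]]opprK -cG.
by rewrite addrC -cF; ring.
Qed.

Lemma coboundary_cocycle al De x p : L_cocycle al De x (coboundary al De x p).
Proof.
move=> l m; rewrite !horner_coboundary !(comp_polyB, comp_polyD, comp_polyM, comp_polyC, comp_polyX).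
rewrite -!comp_polyA !(comp_polyD, comp_polyC, comp_polyX).
have -> : 'X + m%:P + l%:P = 'X + l%:P + m%:P by ring.
rewrite -!addrA -polyCD; ring.
Qed.

Definition transl b F := map_poly (comp_poly ('X + b%:P)) F.

Lemma horner_transl b F l : (transl b F).[l%:P] = F.[l%:P] \Po ('X + b%:P).
Proof. by rewrite /transl -[X in _.[X] = _](comp_polyC l ('X + b%:P)) horner_map. Qed.

Lemma comp_polyXDC p a b : (p \Po ('X + a%:P)) \Po ('X + b%:P) = p \Po ('X + (a + b)%:P).
Proof. by rewrite -comp_polyA comp_polyD comp_polyX comp_polyC polyCD addrAC addrA. Qed.

Lemma translK b : cancel (transl b) (transl (- b)).
Proof.
move=> F; apply: eq_poly_horner => l.
by rewrite !horner_transl comp_polyXDC subrr addr0 comp_polyXr.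
Qed.

Lemma L_cocycle_transl b al De x F :
  L_cocycle al De x F -> L_cocycle (al + b) De x (transl b F).
Proof.
move=> cF l m; rewrite !horner_transl !comp_polyXDC (addrC b) (addrC b) -!comp_polyXDC.
have := congr1 (comp_poly ('X + b%:P)) (cF l m).
rewrite /= !(comp_polyB, comp_polyD, comp_polyM, comp_polyC, comp_polyX) => <-; ring.
Qed.

Lemma N_cocycle_transl b al De x F :
  N_cocycle al De x F -> N_cocycle (al + b) De x (transl b F).
Proof.
move=> cF l m; rewrite !horner_transl !comp_polyXDC (addrC b) -!comp_polyXDC.
have := congr1 (comp_poly ('X + b%:P)) (cF l m).
rewrite /= raddfN /= !(comp_polyB, comp_polyD, comp_polyM, comp_polyC, comp_polyX) => <-; ring.
Qed.

Lemma transl_coboundary b al De x p :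
  transl b (coboundary al De x p) = coboundary (al + b) De x (p \Po ('X + b%:P)).
Proof.
apply: eq_poly_horner => l; rewrite horner_transl !horner_coboundary.
rewrite !(comp_polyB, comp_polyD, comp_polyM, comp_polyC, comp_polyX) !comp_polyXDC.
by rewrite (addrC b); ring.
Qed.

(** * Normal form and uniqueness for [L]-cocycles *)

(** The Euler identity leaves a single total degree, and there the coefficients at [lambda^2] and
    [lambda^3] determine all higher ones. *)
Lemma L_vanish De x F : x != 0 -> L_cocycle 0 De x F ->
  (forall r, F`_1`_r = 0) -> F`_0`_0 = 0 ->
  (forall s, De = x + s.+1%:R -> F`_2`_s = 0 /\ (forall s', s = s'.+1 -> F`_3`_s' = 0)) ->
  F = 0.
Proof.
move=> x0 cF F1 F00 F23.
have F0 r : F`_0`_r = 0.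
  case: r => [//|r]; have := L_coef0 cF r.+1 0.
  by rewrite cob_coef_r0 /= !mul0r => /eqP; rewrite mulf_eq0 (negPf x0) => /eqP.
(* This is the [mu]-linear part, where the coefficient of [F] at [lambda] no longer contributes. *)
have euler i r : F`_i.+2`_r != 0 -> De = x + (r + i.+1)%:R.
  move=> nz; have := L_coef cF i.+1 0 r.
  rewrite !addn0 addn1 !F1 cob_coef_i0 /= !mulr0 subr0 addr0 mul1r -mulrBl => /(mulIf nz).
  rewrite -bin_sub // subSn // subnn bin1 binn natrD => e.
  have -> : De = (De - (r%:R + x)) + (r%:R + x) by ring.
  rewrite e -[i.+2]addn1 natrD; ring.
have F2 r : F`_2`_r = 0.
  apply/eqP/negPn/negP => nz; have e := euler _ _ nz.
  by rewrite addn1 in e; have [e2 _] := F23 _ e; rewrite e2 eqxx in nz.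
have F3 r : F`_3`_r = 0.
  apply/eqP/negPn/negP => nz; have e := euler _ _ nz.
  by rewrite addn2 in e; have [_ e3] := F23 _ e; rewrite (e3 _ erefl) eqxx in nz.
have Fk i : forall r, F`_i.+3`_r = 0.
  elim: i => [//|i IH] r.
  (* The coefficient at [lambda^(i+4)] carries the factor [(i+4) - C(i+4, 2)], which is never 0. *)
  have := L_coef cF 1 i.+2 r; rewrite !F2 !IH !(mulr0, subr0, add0r, oppr0).
  move/esym/eqP; rewrite mulf_eq0 subr_eq0 eqr_nat => /orP [|/eqP //].
  by rewrite add1n bin1 (binS i.+3) (binS i.+2) !bin1 => /eqP e; exfalso; lia.
apply/polyP => i; apply/polyP => r; rewrite coef0 coef0.
by case: i => [|[|[|i]]].
Qed.

(** The coboundary of [d^r] has [lambda]-linear term [(r + x - De) d^r], so a coboundary removes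
    this term of [F] outside the resonant degree. In a resonant degree [r > 0] the cocycle equation
    already forces it to vanish. *)
Lemma L_normalize De x F : x != 0 -> L_cocycle 0 De x F ->
  exists p G, [/\ F = G + coboundary 0 De x p, L_cocycle 0 De x G,
    forall r : nat, De != x \/ r != 0 -> G`_1`_r = 0 & De != x -> G`_0`_0 = 0].
Proof.
move=> x0 cF.
(* In the resonant degree [r = De - x] the division by 0 gives 0. *)
set p := \poly_(r < size F`_1) (F`_1`_r / (r%:R + x - De)).
pose G := F - coboundary 0 De x p.
have cG : L_cocycle 0 De x G by apply: L_cocycleB => //; apply: coboundary_cocycle.
exists p, G; split => //; first by rewrite subrK.
  move=> r hr; have [e|ne] := eqVneq (r%:R + x - De) 0; last first.
    rewrite /G !coefB coef_coboundaryS cob_coef_i0 addn0 mul1r -mulrBl coef_poly.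
    case: ltnP => [_|le]; first by rewrite mulrC divfK // subrr.
    by rewrite nth_default // mulr0 subrr.
  case: r hr e => [|r] hr e.
    by case: hr => // /eqP []; apply/esym/eqP; rewrite -subr_eq0 -e add0r.
  have De_eq : De = r.+1%:R + x by apply/esym/eqP; rewrite -subr_eq0 e.
  (* In the coefficient of [d^0 lambda^(r+2) mu] everything cancels except [x] times the resonant
     coefficient. *)
  have := L_coef cG r.+1 0 0; rewrite !cob_coef_r0 !add0n !addn0 addn1 cob_coef_i0 /=.
  rewrite mul0r subr0 mul1r add0r De_eq -bin_sub // subSn // subnn bin1 binn -[r.+2]addn1 natrD.
  move=> e1; apply: (mulfI x0); rewrite mulr0.
  rewrite -[RHS](subrr ((r.+1%:R + 1 - 1) * G`_(r.+1 + 1)`_0)) -{1}e1; ring.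
move=> ne; have := L_coef0 cG 0 0; rewrite cob_coef_i0 add0r mul1r => /eqP.
by rewrite -subr_eq0 -mulrBl mulf_eq0 subr_eq0 eq_sym (negPf ne) => /eqP.
Qed.

(** The coboundary of the resonant monomial [d^(n+1)] has no [lambda]-linear term: [t] is the
    freedom left by normalization. [L_vanish] reduces equality to two coefficients. *)
Lemma L_cocycle_eq De x n t F G : x != 0 -> De = x + n.+1%:R ->
  L_cocycle 0 De x F -> L_cocycle 0 De x G ->
  (forall r, F`_1`_r = 0) -> (forall r, G`_1`_r = 0) -> F`_0`_0 = 0 -> G`_0`_0 = 0 ->
  F`_2`_n = G`_2`_n + cob_coef x n 1 * t ->
  (forall n', n = n'.+1 -> F`_3`_n' = G`_3`_n' + cob_coef x n' 2 * t) ->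
  F = G + coboundary 0 De x (t%:P * 'X^(n.+1))%R.
Proof.
move=> x0 De_eq cF cG F1 G1 F0 G0 F2 F3.
apply/eqP; rewrite -subr_eq0 opprD addrA; apply/eqP; apply: (@L_vanish De x) => //.
- by apply: L_cocycleB; [apply: L_cocycleB|apply: coboundary_cocycle].
- move=> r; rewrite !coefB F1 G1 coef_coboundaryS cob_coef_i0 addn0 coefCM coefXn De_eq.
  have [->|_] := eqVneq r n.+1; rewrite ?mulr0n ?mulr1n; ring.
- by rewrite !coefB coef_coboundary0 F0 G0 coef0; ring.
- move=> s; rewrite De_eq => /addrI /eqP; rewrite eqr_nat => /eqP [<-].
  have cobE i r : (r + i = n.+1)%N -> i != 0 ->
      (coboundary 0 (x + n.+1%:R) x (t%:P * 'X^(n.+1))%R)`_i.+1`_r = cob_coef x r i * t.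
    move=> e ne; rewrite coef_coboundaryS coefCM coefXn e eqxx (negPf ne) mulr1 !mul0r subr0 //.
  split=> [|n' en]; rewrite !coefB cobE ?en ?addn1 ?addn2 //.
    by rewrite F2; ring.
  by rewrite (F3 _ en); ring.
Qed.

(** * Obstructions for [L]-cocycles in weights 5 and 7 *)

(** Valid also for [m < k]; it turns binomials with symbolic upper index into expressions for
    [field]. *)
Lemma binR (m k : nat) : 'C(m, k.+1)%:R = (m%:R - k%:R) / k.+1%:R * 'C(m, k)%:R :> K.
Proof.
have k0 : k.+1%:R != 0 :> K by rewrite pnatr_eq0.
apply: (mulfI k0); rewrite -natrM mul_bin_left natrM.
have [le|lt] := leqP k m; first by rewrite natrB // mulrA (mulrC k.+1%:R) divfK.
by rewrite bin_small // !mulr0.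
Qed.

Lemma L_coefSS De x F (i j r : nat) : L_cocycle 0 De x F ->
  cob_coef x r i.+1 * F`_j.+2`_(r + i.+1) - cob_coef x r j.+1 * F`_i.+2`_(r + j.+1)
  = ('C((i + j).+3, i.+1)%:R - 'C((i + j).+3, i.+2)%:R) * F`_(i + j).+3`_r.
Proof.
move=> cF; have := L_coef cF i.+1 j.+1 r; rewrite !mul0r subr0 mulr0 add0r => ->.
by rewrite !(addSn, addnS).
Qed.

(* The second factor is, up to a scalar, the determinant of the pair of coefficients at [lambda^2],
   [lambda^3] against that of the coboundary of [d^(N-1)]. *)
Lemma L_weight5 De x F (p : nat) : L_cocycle 0 De x F ->
  let N := p.+4.+2%:R : K in
  (4%:R * x ^+ 2 + (4%:R * N - 8%:R) * x + N ^+ 2 - 7%:R * N + 6%:R) *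
  (F`_2`_p.+4 * ((N - 2%:R) * (N - 3%:R + 3%:R * x))
   - F`_3`_p.+3 * (3%:R * (N - 2%:R + 2%:R * x))) = 0.
Proof.
move=> cF N.
(* [[L_1, L_2]] and [[L_1, L_3]] give the coefficients at [lambda^4] and [lambda^5]; [[L_1, L_4]]
   and [[L_2, L_3]] both give the one at [lambda^6]. *)
have e23 : cob_coef x p.+2 1 * F`_3`_p.+3 - cob_coef x p.+2 2 * F`_2`_p.+4
    = (4%:R - 6%:R) * F`_4`_p.+2.
  by have := L_coefSS 0 1 p.+2 cF; rewrite !(addnS, addn0).
have e24 : cob_coef x p.+1 1 * F`_4`_p.+2 - cob_coef x p.+1 3 * F`_2`_p.+4
    = (5%:R - 10%:R) * F`_5`_p.+1.
  by have := L_coefSS 0 2 p.+1 cF; rewrite !(addnS, addn0).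
have e25 : cob_coef x p 1 * F`_5`_p.+1 - cob_coef x p 4 * F`_2`_p.+4 = (6%:R - 15%:R) * F`_6`_p.
  by have := L_coefSS 0 3 p cF; rewrite !(addnS, addn0).
have e34 : cob_coef x p 2 * F`_4`_p.+2 - cob_coef x p 3 * F`_3`_p.+3 = (15%:R - 20%:R) * F`_6`_p.
  by have := L_coefSS 1 2 p cF; rewrite !(addnS, addn0).
have a4 : F`_4`_p.+2 =
    (cob_coef x p.+2 1 * F`_3`_p.+3 - cob_coef x p.+2 2 * F`_2`_p.+4) / (4%:R - 6%:R).
  by rewrite e23; field.
have a5 : F`_5`_p.+1 =
    (cob_coef x p.+1 1 * F`_4`_p.+2 - cob_coef x p.+1 3 * F`_2`_p.+4) / (5%:R - 10%:R).
  by rewrite e24; field.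
have a6 : F`_6`_p =
    (cob_coef x p 2 * F`_4`_p.+2 - cob_coef x p 3 * F`_3`_p.+3) / (15%:R - 20%:R).
  by rewrite e34; field.
move: e25; rewrite a6 a5 a4 /cob_coef !(addnS, addn0) !binR !bin0 /N.
move: (F`_2`_p.+4) (F`_3`_p.+3) => a2 a3.
move=> /eqP; rewrite -subr_eq0 => /eqP e.
(* The relation times [-240] is [(p+1)(p+2)(p+3)] times the claim. *)
have P0 (i : nat) : (i + p).+1%:R != 0 :> K by rewrite pnatr_eq0.
apply: (mulfI (P0 0%N)); apply: (mulfI (P0 1%N)); apply: (mulfI (P0 2%N)).
rewrite !mulr0 -[RHS](mulr0 (- 240%:R : K)) -e.
by field.
Qed.

(** Both [[L_1, L_6]] and [[L_2, L_5]] produce the coefficient at [lambda^8]. Their comparison again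
    contains the determinant of weight 5. *)
Lemma L_weight7 De x F (q : nat) : L_cocycle 0 De x F ->
  let N := q.+4.+4%:R : K in
  (3%:R * N ^+ 4 + 24%:R * N ^+ 3 * x - 64%:R * N ^+ 3 + 72%:R * N ^+ 2 * x ^+ 2 - 364%:R * N ^+ 2 * x
   + 477%:R * N ^+ 2 + 96%:R * N * x ^+ 3 - 688%:R * N * x ^+ 2 + 1648%:R * N * x - 1376%:R * N
   + 48%:R * x ^+ 4 - 432%:R * x ^+ 3 + 1388%:R * x ^+ 2 - 1792%:R * x + 960%:R) *
  (F`_2`_(q.+4.+2) * ((N - 2%:R) * (N - 3%:R + 3%:R * x))
   - F`_3`_(q.+4.+1) * (3%:R * (N - 2%:R + 2%:R * x))) = 0.
Proof.
move=> cF N.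
have e23 : cob_coef x q.+4 1 * F`_3`_(q.+4.+1) - cob_coef x q.+4 2 * F`_2`_(q.+4.+2)
    = (4%:R - 6%:R) * F`_4`_q.+4.
  by have := L_coefSS 0 1 q.+4 cF; rewrite !(addnS, addn0).
have e24 : cob_coef x q.+3 1 * F`_4`_q.+4 - cob_coef x q.+3 3 * F`_2`_(q.+4.+2)
    = (5%:R - 10%:R) * F`_5`_q.+3.
  by have := L_coefSS 0 2 q.+3 cF; rewrite !(addnS, addn0).
have e25 : cob_coef x q.+2 1 * F`_5`_q.+3 - cob_coef x q.+2 4 * F`_2`_(q.+4.+2)
    = (6%:R - 15%:R) * F`_6`_q.+2.
  by have := L_coefSS 0 3 q.+2 cF; rewrite !(addnS, addn0).
have e26 : cob_coef x q.+1 1 * F`_6`_q.+2 - cob_coef x q.+1 5 * F`_2`_(q.+4.+2)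
    = (7%:R - 21%:R) * F`_7`_q.+1.
  by have := L_coefSS 0 4 q.+1 cF; rewrite !(addnS, addn0).
have e27 : cob_coef x q 1 * F`_7`_q.+1 - cob_coef x q 6 * F`_2`_(q.+4.+2)
    = (8%:R - 28%:R) * F`_8`_q.
  by have := L_coefSS 0 5 q cF; rewrite !(addnS, addn0).
have e36 : cob_coef x q 2 * F`_6`_q.+2 - cob_coef x q 5 * F`_3`_(q.+4.+1)
    = (28%:R - 56%:R) * F`_8`_q.
  by have := L_coefSS 1 4 q cF; rewrite !(addnS, addn0).
have a4 : F`_4`_q.+4 =
    (cob_coef x q.+4 1 * F`_3`_(q.+4.+1) - cob_coef x q.+4 2 * F`_2`_(q.+4.+2)) / (4%:R - 6%:R).
  by rewrite e23; field.
have a5 : F`_5`_q.+3 =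
    (cob_coef x q.+3 1 * F`_4`_q.+4 - cob_coef x q.+3 3 * F`_2`_(q.+4.+2)) / (5%:R - 10%:R).
  by rewrite e24; field.
have a6 : F`_6`_q.+2 =
    (cob_coef x q.+2 1 * F`_5`_q.+3 - cob_coef x q.+2 4 * F`_2`_(q.+4.+2)) / (6%:R - 15%:R).
  by rewrite e25; field.
have a7 : F`_7`_q.+1 =
    (cob_coef x q.+1 1 * F`_6`_q.+2 - cob_coef x q.+1 5 * F`_2`_(q.+4.+2)) / (7%:R - 21%:R).
  by rewrite e26; field.
have a8 : F`_8`_q =
    (cob_coef x q 2 * F`_6`_q.+2 - cob_coef x q 5 * F`_3`_(q.+4.+1)) / (28%:R - 56%:R).
  by rewrite e36; field.
move: e27; rewrite a8 a7 a6 a5 a4 /cob_coef !(addnS, addn0) !binR !bin0 /N.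
move: (F`_2`_(q.+4.+2)) (F`_3`_(q.+4.+1)) => a2 a3.
move=> /eqP; rewrite -subr_eq0 => /eqP e.
have P0 (i : nat) : (i + q).+1%:R != 0 :> K by rewrite pnatr_eq0.
apply: (mulfI (P0 0%N)); apply: (mulfI (P0 1%N)); apply: (mulfI (P0 2%N)).
apply: (mulfI (P0 3%N)); apply: (mulfI (P0 4%N)).
rewrite !mulr0 -[RHS](mulr0 (- 362880%:R : K)) -e.
by field.
Qed.

(** * Homogeneity, uniqueness and obstructions for [N]-cocycles *)

Lemma N_euler De x k : N_cocycle 0 De x k ->
  forall i r : nat, De != x + (r + i)%:R -> k`_i`_r = 0.
Proof.
move=> ck i r; apply: contra_neq_eq => nz.
have := N_coef ck 0 i r; rewrite cob_coef_i0 addn0 add0n bin1 mul1r -mulrBl -mulrDl => /eqP.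
rewrite mulf_eq0 (negPf nz) orbF natrD => /eqP e.
by rewrite -[LHS]addr0 -e; ring.
Qed.

(** By the [mu]-linear relations the coefficient at [lambda] determines those at higher powers; the
    constant term dies because [x] times it vanishes. *)
Lemma N_vanish De x (n : nat) k : x != 0 -> De = x + n.+1%:R ->
  N_cocycle 0 De x k -> k`_1`_n = 0 -> k = 0.
Proof.
move=> x0 De_eq ck k1n.
have sup i r : (r + i != n.+1)%N -> k`_i`_r = 0.
  move=> ne; apply: (N_euler ck); rewrite De_eq.
  by apply: contra ne => /eqP /addrI /eqP; rewrite eqr_nat eq_sym.
have k0 r : k`_0`_r = 0.
  have [er|/sup //] := eqVneq (r + 0)%N n.+1.
  rewrite addn0 in er; rewrite er; have := N_coef ck n.+1 0 0.
  rewrite cob_coef_r0 add0n addn0 bin_small // !mul0r subr0 addr0 => /eqP.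
  by rewrite mulf_eq0 (negPf x0) => /eqP.
have k1 r : k`_1`_r = 0.
  by have [er|/sup //] := eqVneq (r + 1)%N n.+1; move: er; rewrite addn1 => -[->].
apply/polyP => i; apply/polyP => r; rewrite !coef0; case: i => [//|[//|i]].
have := N_coef ck i.+1 1 r; rewrite !k1 addn1 binn mulr0 mulr0 subr0 add0r mul1r //.
Qed.

(** The coefficients at [lambda^2] and [lambda^3] are multiples of the one at [lambda]; the relation
    at [lambda^2 mu^2] tests their consistency. *)
Lemma N_weight3 De x (m : nat) k : N_cocycle 0 De x k ->
  let N := m.+3%:R : K in
  k`_1`_m.+2 * (4%:R * x ^+ 2 + 4%:R * (N - 1) * x + N * (N - 3%:R)) = 0.
Proof.
move=> ck N.
have e1 : cob_coef x m.+1 1 * k`_1`_m.+2 + k`_2`_m.+1 = 0.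
  by have := N_coef ck 1%N 1%N m.+1; rewrite !mul0r subr0 addn1 mul1r.
have e2 : cob_coef x m 2 * k`_1`_m.+2 + k`_3`_m = 0.
  by have := N_coef ck 2%N 1%N m; rewrite !mul0r subr0 addn2 mul1r.
have e3 : cob_coef x m 1 * k`_2`_m.+1 + 3%:R * k`_3`_m = 0.
  by have := N_coef ck 1%N 2%N m; rewrite !mul0r subr0 addn1.
have a2 : k`_2`_m.+1 = - (cob_coef x m.+1 1 * k`_1`_m.+2) by apply/eqP; rewrite -addr_eq0 addrC e1.
have a3 : k`_3`_m = - (cob_coef x m 2 * k`_1`_m.+2) by apply/eqP; rewrite -addr_eq0 addrC e2.
move: e3; rewrite a3 a2 /cob_coef !(addnS, addn0) !binR !bin0 /N; move: (k`_1`_m.+2) => b e.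
have P0 (i : nat) : (i + m).+1%:R != 0 :> K by rewrite pnatr_eq0.
apply: (mulfI (P0 0%N)); apply: (mulfI (P0 1%N)).
rewrite !mulr0 -[RHS](mulr0 (- 4%:R : K)) -e.
by field.
Qed.

(** The same test with [lambda^2] and [lambda^4], at [lambda^3 mu^2]. *)
Lemma N_weight4 De x (m : nat) k : N_cocycle 0 De x k ->
  let N := m.+4%:R : K in
  k`_1`_m.+3 * (6%:R * x ^+ 2 + (5%:R * N - 6%:R) * x + N * (N - 4%:R)) = 0.
Proof.
move=> ck N.
have e1 : cob_coef x m.+2 1 * k`_1`_m.+3 + k`_2`_m.+2 = 0.
  by have := N_coef ck 1%N 1%N m.+2; rewrite !mul0r subr0 addn1 mul1r.
have e2 : cob_coef x m 3 * k`_1`_m.+3 + k`_4`_m = 0.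
  by have := N_coef ck 3%N 1%N m; rewrite !mul0r subr0 addn3 mul1r.
have e3 : cob_coef x m 2 * k`_2`_m.+2 + 4%:R * k`_4`_m = 0.
  by have := N_coef ck 2%N 2%N m; rewrite !mul0r subr0 addn2.
have a2 : k`_2`_m.+2 = - (cob_coef x m.+2 1 * k`_1`_m.+3) by apply/eqP; rewrite -addr_eq0 addrC e1.
have a3 : k`_4`_m = - (cob_coef x m 3 * k`_1`_m.+3) by apply/eqP; rewrite -addr_eq0 addrC e2.
move: e3; rewrite a3 a2 /cob_coef !(addnS, addn0) !binR !bin0 /N; move: (k`_1`_m.+3) => b e.
have P0 (i : nat) : (i + m).+1%:R != 0 :> K by rewrite pnatr_eq0.
apply: (mulfI (P0 0%N)); apply: (mulfI (P0 1%N)); apply: (mulfI (P0 2%N)).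
rewrite !mulr0 -[RHS](mulr0 (- 12%:R : K)) -e.
by field.
Qed.

(** The quadratics of weights 3 and 4 have no common root: a combination is [N (2x + N - 1)], and at
    [2x + N - 1 = 0] the first one equals [- (N + 1)]. *)
Lemma N_vanish_ge4 De x (m : nat) k : x != 0 -> De = x + m.+4%:R ->
  N_cocycle 0 De x k -> k = 0.
Proof.
move=> x0 De_eq ck; apply: (N_vanish x0 De_eq ck).
have := N_weight3 m.+1 ck; have := N_weight4 m ck; set N : K := m.+4%:R => /= e4 e3.
have N0 : N != 0 by rewrite pnatr_eq0.
have N1 : N + 1 != 0 by rewrite natr1 pnatr_eq0.
apply/eqP/negPn/negP => b0.
have {}e3 := mulfI b0 (etrans e3 (esym (mulr0 _))).
have {}e4 := mulfI b0 (etrans e4 (esym (mulr0 _))).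
have e : 2%:R * x + N - 1 = 0.
  apply: (mulfI N0); rewrite mulr0.
  have -> : N * (2%:R * x + N - 1) = 3%:R * (4%:R * x ^+ 2 + 4%:R * (N - 1) * x + N * (N - 3%:R))
     - 2%:R * (6%:R * x ^+ 2 + (5%:R * N - 6%:R) * x + N * (N - 4%:R)) by ring.
  by rewrite e3 e4; ring.
move/eqP: N1; apply.
have -> : N + 1 = (2%:R * x + N - 1) ^+ 2
  - (4%:R * x ^+ 2 + 4%:R * (N - 1) * x + N * (N - 3%:R)) by ring.
by rewrite e e3; ring.
Qed.

(** * Explicit cocycles *)

Local Notation cst c := (c%:P%:P : {poly {poly K}}).
Local Notation db al := (('X + al%:P)%:P : {poly {poly K}}).
Local Notation la := ('X : {poly {poly K}}).

(* [L_soln] and [N_soln] are the cocycles in the paper's list with [Delta - Dbar = n]. *)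
Definition N_sol1 c := cst c * la.
Definition N_sol2 al x c := cst c * la * (db al - cst x * la).
Definition N_sol3 al c := cst c * la * (db al ^+ 2 + cst 3%:R * db al * la + cst 2%:R * la ^+ 2).
Definition L_sol0 c0 c1 := cst c0 + cst c1 * la.
Definition L_sol2 al c := cst c * la ^+ 2 * (cst 2%:R * db al + la).
Definition L_sol3 al c := cst c * db al * la ^+ 2 * (db al + la).
Definition L_sol4 al x c := cst c * la ^+ 2 * (cst 4%:R * db al ^+ 3 + cst 6%:R * db al ^+ 2 * la
                              - db al * la ^+ 2 + cst x * la ^+ 3).
Definition L_sol5 al c := cst c * (db al ^+ 4 * la ^+ 2 - cst 10%:R * db al ^+ 2 * la ^+ 4
                     - cst 17%:R * db al * la ^+ 5 - cst 8%:R * la ^+ 6).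
Definition L_sol6 al x c := cst c * (db al ^+ 4 * la ^+ 3
                     - cst (2%:R * x + 3%:R) * db al ^+ 3 * la ^+ 4
                     - cst (3%:R * x) * db al ^+ 2 * la ^+ 5
                     - cst (3%:R * x + 1) * db al * la ^+ 6
                     - cst (x + 9%:R / 28%:R) * la ^+ 7).

Lemma comp_polyN (p q : {poly K}) : (- p) \Po q = - (p \Po q).
Proof. exact: raddfN. Qed.

Lemma comp_poly_exp (p q : {poly K}) n : (p ^+ n) \Po q = (p \Po q) ^+ n.
Proof. exact: rmorphXn. Qed.

Let evalE := (hornerD, hornerN, hornerM, horner_exp, hornerX, hornerC,
  comp_polyN, comp_polyD, comp_polyM, comp_poly_exp, comp_polyC, comp_polyX).

Lemma N_sol0_cocycle al x c : N_cocycle al x x (cst c).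
Proof. by move=> l m; rewrite !evalE; ring. Qed.

Lemma N_sol1_cocycle al x c : N_cocycle al (x + 1) x (N_sol1 c).
Proof. by move=> l m; rewrite /N_sol1 !evalE; ring. Qed.

Lemma N_sol2_cocycle al x c : N_cocycle al (x + 2%:R) x (N_sol2 al x c).
Proof. by move=> l m; rewrite /N_sol2 !evalE; ring. Qed.

Lemma N_sol3_cocycle al c : N_cocycle al 1 (- 2%:R) (N_sol3 al c).
Proof. by move=> l m; rewrite /N_sol3 !evalE; ring. Qed.

Lemma L_sol0_cocycle al x c0 c1 : L_cocycle al x x (L_sol0 c0 c1).
Proof. by move=> l m; rewrite /L_sol0 !evalE; ring. Qed.

Lemma L_sol2_cocycle al x c : L_cocycle al (x + 2%:R) x (L_sol2 al c).
Proof. by move=> l m; rewrite /L_sol2 !evalE; ring. Qed.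

Lemma L_sol3_cocycle al x c : L_cocycle al (x + 3%:R) x (L_sol3 al c).
Proof. by move=> l m; rewrite /L_sol3 !evalE; ring. Qed.

Lemma L_sol4_cocycle al x c : L_cocycle al (x + 4%:R) x (L_sol4 al x c).
Proof. by move=> l m; rewrite /L_sol4 !evalE; ring. Qed.

Lemma L_sol5_cocycle al c : L_cocycle al 1 (- 4%:R) (L_sol5 al c).
Proof. by move=> l m; rewrite /L_sol5 !evalE; ring. Qed.

Lemma L_sol6_cocycle al x c : 2%:R * x ^+ 2 + 10%:R * x + 3%:R = 0 ->
  L_cocycle al (x + 6%:R) x (L_sol6 al x c).
Proof.
move=> ex.
(* Scaling by 28 clears the denominator of the paper's [9/28]. *)
have c28 : 28%:R != 0 :> K by rewrite pnatr_eq0.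
have -> : c = c / 28%:R * 28%:R by rewrite divfK.
move: (c / 28%:R) => {}c.
have -> : L_sol6 al x (c * 28%:R) = cst c * (cst 28%:R * db al ^+ 4 * la ^+ 3
    - cst (56%:R * x + 84%:R) * db al ^+ 3 * la ^+ 4 - cst (84%:R * x) * db al ^+ 2 * la ^+ 5
    - cst (84%:R * x + 28%:R) * db al * la ^+ 6 - cst (28%:R * x + 9%:R) * la ^+ 7).
  have -> : 28%:R * x + 9%:R = 28%:R * (x + 9%:R / 28%:R) by field.
  by rewrite /L_sol6; move: (x + 9%:R / 28%:R) => w; ring.
move=> l m; rewrite !evalE.
apply/eqP; rewrite -subr_eq0; apply/eqP.
(* The defect of the cocycle equation is a multiple of the quadratic polynomial in [ex]. *)
pose y := 'X + al%:P; pose L := l%:P : {poly K}; pose M := m%:P : {poly K}.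
rewrite -[RHS](mulr0 (c%:P * (84%:R * y ^+ 2 * (L ^+ 4 * M ^+ 2 - L ^+ 2 * M ^+ 4)
  + 84%:R * y * (L ^+ 5 * M ^+ 2 + L ^+ 4 * M ^+ 3 - L ^+ 3 * M ^+ 4 - L ^+ 2 * M ^+ 5)
  + 42%:R * (L ^+ 6 * M ^+ 2 + L ^+ 5 * M ^+ 3 - L ^+ 3 * M ^+ 5 - L ^+ 2 * M ^+ 6)))).
rewrite -[0](polyC0 K) -ex /y /L /M; ring.
Qed.

(** * Lowest coefficients of the explicit cocycles *)

Lemma coef_low1 P (W : {poly {poly K}}) : (P%:P * 'X + 'X^2 * W)`_1 = P.
Proof. by rewrite coefD coefMX coefC coefXnM /= addr0. Qed.

Lemma coef_low3 (P2 P3 : {poly K}) (W : {poly {poly K}})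
    (F := P2%:P * 'X^2 + P3%:P * 'X^3 + 'X^4 * W) :
  [/\ F`_0 = 0, F`_1 = 0, F`_2 = P2 & F`_3 = P3].
Proof.
by split; rewrite !coefD !coefCM !coefXnM !coefXn /= ?mulr0 ?mulr1 ?add0r ?addr0.
Qed.

Lemma coef_monomial (c : K) (n : nat) : (c%:P * 'X^n)`_n = c.
Proof. by rewrite coefCM coefXn eqxx mulr1. Qed.

Lemma N_sol2_low x c : N_sol2 0 x c = (c%:P * 'X^1)%:P * 'X + 'X^2 * - cst (c * x).
Proof. by rewrite /N_sol2 addr0; ring. Qed.

Lemma N_sol3_low c : N_sol3 0 c =
  (c%:P * 'X^2)%:P * 'X + 'X^2 * (cst c * (cst 3%:R * 'X%:P + cst 2%:R * 'X)).
Proof. by rewrite /N_sol3 addr0; ring. Qed.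

Lemma L_sol2_low c : L_sol2 0 c =
  ((c * 2%:R)%:P * 'X^1)%:P * 'X^2 + (c%:P * 'X^0)%:P * 'X^3 + 'X^4 * 0.
Proof. by rewrite /L_sol2 addr0; ring. Qed.

Lemma L_sol3_low c : L_sol3 0 c = (c%:P * 'X^2)%:P * 'X^2 + (c%:P * 'X^1)%:P * 'X^3 + 'X^4 * 0.
Proof. by rewrite /L_sol3 addr0; ring. Qed.

Lemma L_sol4_low x c : L_sol4 0 x c =
  ((c * 4%:R)%:P * 'X^3)%:P * 'X^2 + ((c * 6%:R)%:P * 'X^2)%:P * 'X^3
  + 'X^4 * (cst c * (cst x * 'X - 'X%:P)).
Proof. by rewrite /L_sol4 addr0; ring. Qed.

Lemma L_sol5_low c : L_sol5 0 c = (c%:P * 'X^4)%:P * 'X^2 + (0%:P * 'X^3)%:P * 'X^3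
  + 'X^4 * (- cst c * (cst 10%:R * 'X%:P ^+ 2 + cst 17%:R * 'X%:P * 'X + cst 8%:R * 'X ^+ 2)).
Proof. by rewrite /L_sol5 addr0; ring. Qed.

Lemma L_sol6_low x c : L_sol6 0 x c = (0%:P * 'X^5)%:P * 'X^2 + (c%:P * 'X^4)%:P * 'X^3
  + 'X^4 * (- cst c * (cst (2%:R * x + 3%:R) * 'X%:P ^+ 3 + cst (3%:R * x) * 'X%:P ^+ 2 * 'X
     + cst (3%:R * x + 1) * 'X%:P * 'X ^+ 2 + cst (x + 9%:R / 28%:R) * 'X ^+ 3)).
Proof. by rewrite /L_sol6 addr0; move: (x + 9%:R / 28%:R) => w; ring. Qed.

(** * Classification of cocycles for [alpha = 0] *)

(** For [n > 0] a cocycle is compared with the explicit one having the same coefficient at [lambda];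
    for [n = 0] homogeneity leaves a constant. *)
Lemma N_classify x (n : nat) k : x != 0 -> N_cocycle 0 (x + n%:R) x k ->
  match n with
  | 0 => exists c, k = cst c
  | 1 => exists c, k = N_sol1 c
  | 2 => exists c, k = N_sol2 0 x c
  | 3 => k = 0 \/ (x = - 2%:R /\ exists c, k = N_sol3 0 c)
  | _ => k = 0
  end.
Proof.
move=> x0 ck; case: n ck => [|[|[|[|n]]]] ck.
- exists k`_0`_0; apply/polyP => i; apply/polyP => r.
  rewrite coefC; case: eqVneq => [->|i0]; rewrite ?coefC.
    case: eqVneq => [-> //|r0]; apply: (N_euler ck).
    by rewrite (inj_eq (addrI _)) eqr_nat addn0 eq_sym.
  rewrite if_same; apply: (N_euler ck).
  by rewrite (inj_eq (addrI _)) eqr_nat eq_sym addn_eq0 negb_and i0 orbT.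
- exists k`_1`_0; apply/eqP; rewrite -subr_eq0; apply/eqP.
  apply: (@N_vanish _ x 0 _ x0 erefl); first exact: N_cocycleB ck (N_sol1_cocycle _ _ _).
  by rewrite !coefB coefCM coefX mulr1 coefC subrr.
- exists k`_1`_1; apply/eqP; rewrite -subr_eq0; apply/eqP.
  apply: (@N_vanish _ x 1 _ x0 erefl); first exact: N_cocycleB ck (N_sol2_cocycle _ _ _).
  by rewrite !coefB N_sol2_low coef_low1 coef_monomial subrr.
- have := N_weight3 0 ck => /eqP; rewrite mulf_eq0 => /orP [/eqP b0|/eqP e].
    by left; apply: (@N_vanish _ x 2 _ x0 erefl).
  (* At [N = 3] the weight 3 quadratic is [4 x (x + 2)]. *)
  have /eqP : x * (x + 2%:R) = 0.
    apply: (@mulfI _ 4%:R); first by rewrite pnatr_eq0.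
    by rewrite mulr0 -e; ring.
  rewrite mulf_eq0 (negPf x0) /= addr_eq0 => /eqP ex; right; split => //.
  exists k`_1`_2; apply/eqP; rewrite -subr_eq0; apply/eqP.
  have De1 : x + 3%:R = 1 by rewrite ex; ring.
  apply: (@N_vanish _ x 2 _ x0 erefl).
    by apply: N_cocycleB ck _; rewrite De1 ex; apply: N_sol3_cocycle.
  by rewrite !coefB N_sol3_low coef_low1 coef_monomial subrr.
- exact: N_vanish_ge4 x0 erefl ck.
Qed.

Lemma cob_coef1 x (n : nat) : cob_coef x n 1 = n.+1%:R * (n%:R + 2%:R * x) / 2%:R.
Proof. by rewrite /cob_coef addn1 !binR bin0; field. Qed.

Lemma cob_coef2 x (n : nat) : cob_coef x n 2 = n.+2%:R * n.+1%:R * (n%:R + 3%:R * x) / 6%:R.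
Proof. by rewrite /cob_coef addn2 !binR bin0; field. Qed.

(** A vanishing determinant makes the pairs proportional because the coboundary pair is nonzero:
    [3 u - 2 v = n + 3] excludes [u = v = 0]. *)
Lemma cob_coef_parallel x (n : nat) (a2 a3 : K) (N := n.+3%:R : K) :
  a2 * ((N - 2%:R) * (N - 3%:R + 3%:R * x)) - a3 * (3%:R * (N - 2%:R + 2%:R * x)) = 0 ->
  exists t, a2 = cob_coef x n.+1 1 * t /\ a3 = cob_coef x n 2 * t.
Proof.
rewrite cob_coef1 cob_coef2 /N.
have n1 : n.+1%:R != 0 :> K by rewrite pnatr_eq0.
have n2 : n.+2%:R != 0 :> K by rewrite pnatr_eq0.
have n3 : n.+3%:R != 0 :> K by rewrite pnatr_eq0.
set u := n.+1%:R + 2%:R * x; set v := n%:R + 3%:R * x.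
have -> : n.+3%:R - 2%:R + 2%:R * x = u by rewrite /u; ring.
have -> : n.+3%:R - 3%:R + 3%:R * x = v by rewrite /v; ring.
have -> : n.+3%:R - 2%:R = n.+1%:R :> K by ring.
move=> /eqP; rewrite subr_eq0 => /eqP e.
have [u0|u0] := eqVneq u 0.
  have v0 : v != 0.
    apply: contraNneq n3 => v0; apply/eqP.
    have -> : n.+3%:R = 3%:R * u - 2%:R * v by rewrite /u /v; ring.
    by rewrite u0 v0; ring.
  have a20 : a2 = 0.
    by move: e; rewrite u0 !mulr0 => /eqP; rewrite !mulf_eq0 (negPf n1) (negPf v0) !orbF => /eqP.
  exists (a3 / (n.+2%:R * n.+1%:R * v / 6%:R)); split; first by rewrite a20 u0; ring.
  by rewrite mulrC divfK // !mulf_neq0 // invr_neq0 // pnatr_eq0.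
exists (a2 / (n.+2%:R * u / 2%:R)); split.
  by rewrite mulrC divfK // !mulf_neq0 // invr_neq0 // pnatr_eq0.
have -> : a3 = a2 * (n.+1%:R * v) / (3%:R * u) by rewrite e mulfK // mulf_neq0 // pnatr_eq0.
move: n1 n2 u0; clearbody u v; move: (n.+1%:R : K) (n.+2%:R : K) => N1 N2 n1 n2 u0.
by field; rewrite u0 n2.
Qed.

Lemma L_cocycle_eq_low x (n : nat) c2 c3 t F G W : x != 0 ->
  L_cocycle 0 (x + n.+2%:R) x F -> L_cocycle 0 (x + n.+2%:R) x G ->
  G = (c2%:P * 'X^(n.+1))%:P * 'X^2 + (c3%:P * 'X^n)%:P * 'X^3 + 'X^4 * W ->
  (forall r, F`_1`_r = 0) -> F`_0`_0 = 0 ->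
  F`_2`_n.+1 = c2 + cob_coef x n.+1 1 * t -> F`_3`_n = c3 + cob_coef x n 2 * t ->
  exists p, F = G + coboundary 0 (x + n.+2%:R) x p.
Proof.
move=> x0 cF cG eG F1 F0 F2 F3.
have [G0 G1 G2 G3] := coef_low3 (c2%:P * 'X^(n.+1)) (c3%:P * 'X^n) W; rewrite -eG in G0 G1 G2 G3.
exists (t%:P * 'X^(n.+2)); apply: (L_cocycle_eq x0 erefl cF cG) => //.
- by move=> r; rewrite G1 coef0.
- by rewrite G0 coef0.
- by rewrite G2 coef_monomial.
- by move=> _ [<-]; rewrite G3 coef_monomial.
Qed.

Lemma L_coboundary_of_low x (n : nat) t F : x != 0 ->
  L_cocycle 0 (x + n.+2%:R) x F -> (forall r, F`_1`_r = 0) -> F`_0`_0 = 0 ->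
  F`_2`_n.+1 = cob_coef x n.+1 1 * t -> F`_3`_n = cob_coef x n 2 * t ->
  exists p, F = 0 + coboundary 0 (x + n.+2%:R) x p.
Proof.
move=> x0 cF F1 F0 F2 F3; exists (t%:P * 'X^(n.+2)).
apply: (L_cocycle_eq x0 erefl cF) => //; rewrite ?coef0 ?add0r //; first exact: L_cocycle0.
- by move=> r; rewrite !coef0.
- by move=> _ [<-]; rewrite !coef0 add0r.
Qed.

(** [15 + 6 x] is the [lambda^2] coefficient [cob_coef x 5 1] of the coboundary of [d^6], and a
    multiple of the derivative of the quadratic, whose roots are simple. *)
Lemma quadratic_not_root x : 2%:R * x ^+ 2 + 10%:R * x + 3%:R = 0 -> 15%:R + 6%:R * x != 0.
Proof.
move=> ex; have n19 : 19%:R != 0 :> K by rewrite pnatr_eq0.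
apply: contraNneq n19 => nx; apply/eqP.
have -> : 19%:R = (15%:R + 6%:R * x) * (2%:R * x + 5%:R) / 3%:R
  - 2%:R * (2%:R * x ^+ 2 + 10%:R * x + 3%:R) by field.
by rewrite nx ex; ring.
Qed.

(** After normalization only the pair of coefficients at [lambda^2] and [lambda^3] matters. For
    [r = 2, 3, 4] the explicit cocycle and the resonant coboundary span all pairs; from [r = 5] on
    the weight 5 obstruction applies, from [r = 7] on also that of weight 7. *)
Lemma L_classify x (r : nat) F : x != 0 -> L_cocycle 0 (x + r%:R) x F ->
  exists p G, F = G + coboundary 0 (x + r%:R) x p /\
  match r with
  | 0 => exists c0 c1, G = L_sol0 c0 c1
  | 2 => exists c, G = L_sol2 0 c
  | 3 => exists c, G = L_sol3 0 c
  | 4 => exists c, G = L_sol4 0 x c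
  | 5 => G = 0 \/ (x = - 4%:R /\ exists c, G = L_sol5 0 c)
  | 6 => G = 0 \/ (2%:R * x ^+ 2 + 10%:R * x + 3%:R = 0 /\ exists c, G = L_sol6 0 x c)
  | _ => G = 0
  end.
Proof.
move=> x0 cF; have [p [G [-> cG G1 G0]]] := L_normalize x0 cF.
suff [q [H [-> hH]]] : exists q H, G = H + coboundary 0 (x + r%:R) x q /\
  match r with
  | 0 => exists c0 c1, H = L_sol0 c0 c1
  | 2 => exists c, H = L_sol2 0 c
  | 3 => exists c, H = L_sol3 0 c
  | 4 => exists c, H = L_sol4 0 x c
  | 5 => H = 0 \/ (x = - 4%:R /\ exists c, H = L_sol5 0 c)
  | 6 => H = 0 \/ (2%:R * x ^+ 2 + 10%:R * x + 3%:R = 0 /\ exists c, H = L_sol6 0 x c)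
  | _ => H = 0
  end.
  exists (p + q), H; split=> //.
  rewrite -addrA; congr (_ + _); apply: eq_poly_horner => l.
  by rewrite hornerD !horner_coboundary comp_polyD; ring.
have ne s : x + s.+1%:R != x by rewrite -subr_eq0 addrAC subrr add0r pnatr_eq0.
case: r cF cG G1 G0 => [|r] cF cG G1 G0.
  rewrite addr0 in cG *.
  exists 0, (L_sol0 G`_0`_0 G`_1`_0); split; last by do 2 eexists.
  have cob0 : coboundary 0 x x 0 = 0.
    by apply: eq_poly_horner => l; rewrite horner_coboundary comp_poly0 horner0; ring.
  rewrite cob0 addr0; apply/eqP; rewrite -subr_eq0; apply/eqP; apply: (@L_vanish x x) => //.
  - exact: L_cocycleB cG (L_sol0_cocycle _ _ _ _).
  - move=> s; rewrite 2!coefB coefD coefC coefCM coefX mulr1 add0r coefC.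
    case: s => [|s] /=; first by rewrite subrr.
    by rewrite subr0; apply: G1; right.
  - by rewrite 2!coefB coefD coefC coefCM coefX mulr0 addr0 coefC subrr.
  - by move=> s /esym /eqP; rewrite (negPf (ne s)).
have {}G1 s : G`_1`_s = 0 by apply: G1; left; apply: ne.
have {}G0 : G`_0`_0 = 0 by apply: G0; apply: ne.
case: r cF cG => [|[|[|[|n]]]] cF cG.
(* For [r = 1] only [d^0 lambda^2] is left, and the coboundary of [d] has coefficient [x] there. *)
- exists ((G`_2`_0 / x)%:P * 'X^1), 0; split => //.
  apply: (L_cocycle_eq x0 erefl cG) => //; rewrite ?coef0 //.
  + exact: L_cocycle0.
  + by move=> s; rewrite !coef0.
  + by rewrite cob_coef_r0 add0r mulrC divfK.
(* Here and below [t] and [c] solve the linear system writing the pair of [G] as a coboundary part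
   plus an explicit part. *)
- pose t := G`_2`_1 - 2%:R * G`_3`_0.
  pose c := G`_3`_0 - x * t.
  have [q e] : exists q, G = L_sol2 0 c + coboundary 0 (x + 2%:R) x q.
    apply: (L_cocycle_eq_low (t := t) x0 cG (L_sol2_cocycle 0 x c) (L_sol2_low _) G1 G0).
      by rewrite cob_coef1 /c /t; field.
    by rewrite cob_coef2 /c; field.
  by exists q, (L_sol2 0 c); split => //; exists c.
- pose t := (G`_2`_2 - G`_3`_1) / 2%:R.
  pose c := G`_2`_2 - (3%:R + 3%:R * x) * t.
  have [q e] : exists q, G = L_sol3 0 c + coboundary 0 (x + 3%:R) x q.
    apply: (L_cocycle_eq_low (t := t) x0 cG (L_sol3_cocycle 0 x c) (L_sol3_low _) G1 G0).
      by rewrite cob_coef1 /c; field.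
    by rewrite cob_coef2 /c /t; field.
  by exists q, (L_sol3 0 c); split => //; exists c.
- pose t := (6%:R * G`_2`_3 - 4%:R * G`_3`_2) / 20%:R.
  pose c := (G`_2`_3 - (6%:R + 4%:R * x) * t) / 4%:R.
  have [q e] : exists q, G = L_sol4 0 x c + coboundary 0 (x + 4%:R) x q.
    apply: (L_cocycle_eq_low (t := t) x0 cG (L_sol4_cocycle 0 x c) (L_sol4_low _ _) G1 G0).
      by rewrite cob_coef1 /c; field.
    by rewrite cob_coef2 /c /t; field.
  by exists q, (L_sol4 0 x c); split => //; exists c.
have /= w5 := L_weight5 n cG.
pose N := n.+4.+2%:R : K.
(* If this determinant is 0, [G] is a coboundary; otherwise the weight 5 quadratic vanishes. *)
pose d := G`_2`_n.+4 * ((N - 2%:R) * (N - 3%:R + 3%:R * x))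
  - G`_3`_n.+3 * (3%:R * (N - 2%:R + 2%:R * x)).
have par : d = 0 ->
    exists p, G = 0 + coboundary 0 (x + n.+4.+1%:R) x p.
  move=> eN; have [t [e2 e3]] := @cob_coef_parallel x n.+3 _ _ eN.
  exact: (L_coboundary_of_low x0 cG G1 G0 e2 e3).
have [/par [q e]|D0] := eqVneq d 0.
  exists q, 0; split=> //; case: (n) => [|[|//]]; by left.
move: w5 => /eqP; rewrite -/N -/d mulf_eq0 (negPf D0) orbF /N => /eqP w5.
case: n cF cG w5 @N @d par D0 => [|[|q]] cF cG w5 N d par D0.
- have /eqP : x * (x + 4%:R) = 0.
    by apply: (@mulfI _ 4%:R); rewrite ?pnatr_eq0 // mulr0 -w5; ring.
  rewrite mulf_eq0 (negPf x0) /= addr_eq0 => /eqP ex.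
  pose t := - (G`_3`_3 / 30%:R).
  pose c := G`_2`_4 + 10%:R * t.
  have De1 : x + 5%:R = 1 by rewrite ex; ring.
  have cS : L_cocycle 0 (x + 5%:R) x (L_sol5 0 c) by rewrite De1 ex; apply: L_sol5_cocycle.
  have [q e] : exists q, G = L_sol5 0 c + coboundary 0 (x + 5%:R) x q.
    apply: (L_cocycle_eq_low (t := t) x0 cG cS (L_sol5_low _) G1 G0).
      by rewrite cob_coef1 /c ex; field.
    by rewrite cob_coef2 /t ex; field.
  by exists q, (L_sol5 0 c); split => //; right; split => //; exists c.
- have ex : 2%:R * x ^+ 2 + 10%:R * x + 3%:R = 0.
    by apply: (@mulfI _ 2%:R); rewrite ?pnatr_eq0 // mulr0 -w5; ring.
  have nx := quadratic_not_root ex.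
  pose t := G`_2`_5 / (15%:R + 6%:R * x).
  pose c := G`_3`_4 - (20%:R + 15%:R * x) * t.
  have [q e] : exists q, G = L_sol6 0 x c + coboundary 0 (x + 6%:R) x q.
    apply: (L_cocycle_eq_low (t := t) x0 cG (L_sol6_cocycle 0 c ex) (L_sol6_low _ _) G1 G0).
      by rewrite cob_coef1 /t; field.
    by rewrite cob_coef2 /c; field.
  by exists q, (L_sol6 0 x c); split => //; right; split => //; exists c.
exfalso; have := L_weight7 q cG; rewrite -/N -/d => /eqP.
rewrite mulf_eq0 (negPf D0) orbF => /eqP w7.
have n1 : 3%:R * q.+4.+3%:R * q.+4.+2%:R != 0 :> K by rewrite !mulf_neq0 // pnatr_eq0.
move/eqP: n1; apply.
(* The weight 7 quartic is a multiple of the weight 5 quadratic minus [3 (N - 1) (N - 2)]. *)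
have -> : 3%:R * q.+4.+3%:R * q.+4.+2%:R = 3%:R * (N - 1) * (N - 2%:R) by rewrite /N; ring.
rewrite -[RHS](mulr0 (3%:R * N ^+ 2 + 12%:R * N * x - 43%:R * N
  + 12%:R * x ^+ 2 - 84%:R * x + 161%:R)).
rewrite -[RHS]subr0 -{1}w5 -w7 -/N; ring.
Qed.

Lemma L_classify_generic De x F : x != 0 -> (forall r : nat, De != x + r%:R) -> L_cocycle 0 De x F ->
  exists p, F = coboundary 0 De x p.
Proof.
move=> x0 ne cF; have [p [G [-> cG G1 G0]]] := L_normalize x0 cF.
have nex : De != x by rewrite -[x]addr0; apply: (ne 0%N).
exists p; suff -> : G = 0 by rewrite add0r.
apply: (L_vanish x0 cG) => //; first by move=> r; apply: G1; left.
  exact: G0.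
by move=> s /eqP; rewrite (negPf (ne _)).
Qed.

(** * Degenerate parameters, the root of 19, and translation to general [alpha] *)

Lemma N_sol1_0 : N_sol1 (0 : K) = 0.
Proof. by rewrite /N_sol1 !polyC0 !mul0r. Qed.

Lemma N_sol2_0 al x : N_sol2 al x (0 : K) = 0.
Proof. by rewrite /N_sol2 !polyC0 !mul0r. Qed.

Lemma N_sol3_0 al : N_sol3 al (0 : K) = 0.
Proof. by rewrite /N_sol3 !polyC0 !mul0r. Qed.

Lemma L_sol0_0 : L_sol0 (0 : K) 0 = 0.
Proof. by rewrite /L_sol0 !polyC0 !mul0r addr0. Qed.

Lemma L_sol2_0 al : L_sol2 al (0 : K) = 0.
Proof. by rewrite /L_sol2 !polyC0 !mul0r. Qed.

Lemma L_sol3_0 al : L_sol3 al (0 : K) = 0.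
Proof. by rewrite /L_sol3 !polyC0 !mul0r. Qed.

Lemma L_sol4_0 al x : L_sol4 al x (0 : K) = 0.
Proof. by rewrite /L_sol4 !polyC0 !mul0r. Qed.

Lemma L_sol5_0 al : L_sol5 al (0 : K) = 0.
Proof. by rewrite /L_sol5 !polyC0 !mul0r. Qed.

Lemma L_sol6_0 al x : L_sol6 al x (0 : K) = 0.
Proof. by rewrite /L_sol6 !polyC0 !mul0r. Qed.

Lemma quadratic_sqrt19 x : 2%:R * x ^+ 2 + 10%:R * x + 3%:R = 0 ->
  exists s : K, s ^+ 2 = 19%:R /\ x + 6%:R = 7%:R / 2%:R + s / 2%:R /\ x = - (5%:R / 2%:R) + s / 2%:R.
Proof.
move=> ex; exists (2%:R * x + 5%:R); split; last by split; field.
have -> : (2%:R * x + 5%:R) ^+ 2 = 19%:R + 2%:R * (2%:R * x ^+ 2 + 10%:R * x + 3%:R) by ring.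
by rewrite ex mulr0 addr0.
Qed.

Lemma sqrt19_quadratic x s : s ^+ 2 = 19%:R -> x = - (5%:R / 2%:R) + s / 2%:R ->
  2%:R * x ^+ 2 + 10%:R * x + 3%:R = 0.
Proof.
move=> es ->; rewrite [LHS](_ : _ = (s ^+ 2 - 19%:R) / 2%:R); last by field.
by rewrite es subrr mul0r.
Qed.

Lemma transl_N_sol0 b c : transl b (cst c) = cst c.
Proof. by rewrite /transl map_polyC /= comp_polyC. Qed.

Lemma transl_N_sol1 b c : transl b (N_sol1 c) = N_sol1 c.
Proof. by apply: eq_poly_horner => l; rewrite horner_transl /N_sol1 !evalE; ring. Qed.

Lemma N_sol2_transl al x c : N_sol2 al x c = transl al (N_sol2 0 x c).
Proof. by apply: eq_poly_horner => l; rewrite horner_transl /N_sol2 !evalE; ring. Qed.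

Lemma N_sol3_transl al c : N_sol3 al c = transl al (N_sol3 0 c).
Proof. by apply: eq_poly_horner => l; rewrite horner_transl /N_sol3 !evalE; ring. Qed.

Lemma transl_L_sol0 b c0 c1 : transl b (L_sol0 c0 c1) = L_sol0 c0 c1.
Proof. by apply: eq_poly_horner => l; rewrite horner_transl /L_sol0 !evalE; ring. Qed.

Lemma L_sol2_transl al c : L_sol2 al c = transl al (L_sol2 0 c).
Proof. by apply: eq_poly_horner => l; rewrite horner_transl /L_sol2 !evalE; ring. Qed.

Lemma L_sol3_transl al c : L_sol3 al c = transl al (L_sol3 0 c).
Proof. by apply: eq_poly_horner => l; rewrite horner_transl /L_sol3 !evalE; ring. Qed.

Lemma L_sol4_transl al x c : L_sol4 al x c = transl al (L_sol4 0 x c).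
Proof. by apply: eq_poly_horner => l; rewrite horner_transl /L_sol4 !evalE; ring. Qed.

Lemma L_sol5_transl al c : L_sol5 al c = transl al (L_sol5 0 c).
Proof. by apply: eq_poly_horner => l; rewrite horner_transl /L_sol5 !evalE; ring. Qed.

Lemma L_sol6_transl al x c : L_sol6 al x c = transl al (L_sol6 0 x c).
Proof.
apply: eq_poly_horner => l; rewrite horner_transl /L_sol6 !evalE.
by move: (x + 9%:R / 28%:R) => w; ring.
Qed.

(** * Explicit cocycles are not coboundaries *)

(** The same coefficient of [p], at [d^(n+2)], feeds both [d^(n+1) lambda^2] and [d^n lambda^3]. *)
Lemma coboundary_low De x (n : nat) c2 c3 (W : {poly {poly K}}) p :
  (c2%:P * 'X^(n.+1))%:P * 'X^2 + (c3%:P * 'X^n)%:P * 'X^3 + 'X^4 * W = coboundary 0 De x p ->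
  exists t, c2 = cob_coef x n.+1 1 * t /\ c3 = cob_coef x n 2 * t.
Proof.
move=> e; exists p`_n.+2.
have [_ _ e2 e3] := coef_low3 (c2%:P * 'X^(n.+1)) (c3%:P * 'X^n) W; rewrite e in e2 e3.
split; first by rewrite -[LHS](coef_monomial c2 n.+1) -e2 coef_coboundaryS mul0r mul0r subr0 addn1.
by rewrite -[LHS](coef_monomial c3 n) -e3 coef_coboundaryS mul0r mul0r subr0 addn2.
Qed.

Lemma coboundary_transl al De x p F : F = coboundary al De x p ->
  exists q, transl (- al) F = coboundary 0 De x q.
Proof. by move=> ->; rewrite transl_coboundary subrr; eexists. Qed.

Lemma L_sol0_coboundary al x c0 c1 p : L_sol0 c0 c1 = coboundary al x x p -> c0 = 0 /\ c1 = 0.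
Proof.
case/coboundary_transl => q; rewrite transl_L_sol0 => e; split.
  have := coef_coboundary0 x x q; rewrite -e coefD coefC coefCM coefX mulr0 addr0 /= => e0.
  by rewrite -[LHS](coefC c0 0) e0 coef0.
have := coef_coboundaryS x x q 0 0; rewrite -e coefD coefC coefCM coefX mulr1 add0r coefC /= => ->.
by rewrite cob_coef_i0; ring.
Qed.

Lemma L_sol2_coboundary al De x c p : L_sol2 al c = coboundary al De x p -> c = 0.
Proof.
case/coboundary_transl => q; rewrite L_sol2_transl translK L_sol2_low => /coboundary_low [t [e2 e3]].
have t0 : t = 0.
  (* This combination vanishes on the pair of the explicit cocycle; the next lemmas use analogous
     ones. *)
  have -> : t = cob_coef x 1 1 * t - 2%:R * (cob_coef x 0 2 * t) by rewrite cob_coef1 cob_coef2; field.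
  by rewrite -e2 -e3; ring.
by rewrite e3 t0 mulr0.
Qed.

Lemma L_sol3_coboundary al De x c p : L_sol3 al c = coboundary al De x p -> c = 0.
Proof.
case/coboundary_transl => q; rewrite L_sol3_transl translK L_sol3_low => /coboundary_low [t [e2 e3]].
have t0 : t = 0.
  have -> : t = (cob_coef x 2 1 * t - cob_coef x 1 2 * t) / 2%:R by rewrite cob_coef1 cob_coef2; field.
  by rewrite -e2 -e3 subrr mul0r.
by rewrite e3 t0 mulr0.
Qed.

Lemma L_sol4_coboundary al De x c p : L_sol4 al x c = coboundary al De x p -> c = 0.
Proof.
case/coboundary_transl => q; rewrite L_sol4_transl translK L_sol4_low => /coboundary_low [t [e2 e3]].
have t0 : t = 0.
  have -> : t = (6%:R * (cob_coef x 3 1 * t) - 4%:R * (cob_coef x 2 2 * t)) / 20%:R.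
    by rewrite cob_coef1 cob_coef2; field.
  by rewrite -e2 -e3; ring.
by move: e2 => /eqP; rewrite t0 mulr0 mulf_eq0 pnatr_eq0 orbF => /eqP.
Qed.

Lemma L_sol5_coboundary al De c p : L_sol5 al c = coboundary al De (- 4%:R) p -> c = 0.
Proof.
case/coboundary_transl => q; rewrite L_sol5_transl translK L_sol5_low => /coboundary_low [t [e2 e3]].
have t0 : t = 0.
  have -> : t = - (cob_coef (- 4%:R) 3 2 * t) / 30%:R by rewrite cob_coef2; field.
  by rewrite -e3 oppr0 mul0r.
by rewrite e2 t0 mulr0.
Qed.

Lemma L_sol6_coboundary al De x c p : 15%:R + 6%:R * x != 0 ->
  L_sol6 al x c = coboundary al De x p -> c = 0.
Proof.
move=> nx; case/coboundary_transl => q.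
rewrite L_sol6_transl translK L_sol6_low => /coboundary_low [t [e2 e3]].
have t0 : t = 0.
  by apply: (mulfI nx); rewrite mulr0 e2 cob_coef1; field.
by rewrite e3 t0 mulr0.
Qed.

End Cocycles.

(** * Extensions as pairs of cocycles *)

(** Reduces a consequence of one equation, with multiplier [c], to a [ring] identity. *)
Lemma eq_subr_comb (A : pzRingType) (c a b u v : A) :
  u = v -> a - b = c * (u - v) -> a = b.
Proof. by move=> ->; rewrite subrr mulr0 => /eqP; rewrite subr_eq0 => /eqP. Qed.

Section Extensions.
Variable R : realType.
Local Notation C := R[i].
Implicit Types (al De x : C) (D : ext_data R) (f k : {poly {poly C}}).

Let simpE := (horner0, comp_poly0, comp_polyN, comp_polyD, comp_polyM, comp_polyC, comp_polyX,
  comp_polyXDC).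

(** The axiom is applied to [v]. Since [M], [Y], [N] kill [vbar] and send [v] into its span,
    [[N, M]] and [[N, Y]] act by 0 on [v], hence so do [2M] and [Y]. *)
Lemma conformal_ext_cocycles al De x D : is_conformal_ext al De x D ->
  [/\ L_cocycle al De x (ext_f D), N_cocycle al De x (ext_k D), ext_g D = 0 & ext_h D = 0].
Proof.
case: D => f g h k H; split=> /=.
- move=> l m; have := congr1 fst (H GL GL l m (0, 1)).
  rewrite /sv_br /= !big_cons big_nil /= /dshift /lev !simpE addr0 -mul_polyC => e.
  by apply: (eq_subr_comb (c := 1) e); ring.
- move=> l m; have := congr1 fst (H GL GN l m (0, 1)).
  rewrite /sv_br /= !big_cons big_nil /= /dshift /lev !simpE addr0 -mul_polyC => e.
  by apply: (eq_subr_comb (c := 1) e); ring.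
- apply: eq_poly_horner => l; have := congr1 fst (H GN GM l 0 (0, 1)).
  rewrite /sv_br /= !big_cons big_nil /= /dshift /lev !simpE !addr0 -mul_polyC => e.
  apply: (@mulfI _ 2%:P); first by rewrite polyC_eq0 pnatr_eq0.
  by apply: (eq_subr_comb (c := - 1) e); ring.
- apply: eq_poly_horner => l; have := congr1 fst (H GN GY l 0 (0, 1)).
  rewrite /sv_br /= !big_cons big_nil /= /dshift /lev !simpE !addr0 -mul_polyC => e.
  by apply: (eq_subr_comb (c := - 1) e); ring.
Qed.

Lemma cocycles_conformal_ext al De x f k : L_cocycle al De x f -> N_cocycle al De x k ->
  is_conformal_ext al De x (ExtData f 0 0 k).
Proof.
move=> cf ck a b l m [p q].
apply: injective_projections; case: a; case: b;
  rewrite /sv_br /= ?big_cons big_nil /= /dshift /lev ?simpE -?mul_polyC ?(addrC m l);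
  (* The last three cases are [(L, L)], [(L, N)] and [(N, L)]; the last is the second with [lambda],
     [mu] exchanged and the sign reversed. *)
  first [ by ring
        | by apply: (eq_subr_comb (c := q \Po ('X + (l + m)%:P)) (cf l m)); ring
        | by apply: (eq_subr_comb (c := q \Po ('X + (l + m)%:P)) (ck l m)); ring
        | by apply: (eq_subr_comb (c := - (q \Po ('X + (l + m)%:P))) (ck m l));
             rewrite (addrC m l); ring ].
Qed.

(** The equivalence sends [v] to [v + p vbar]; [g], [h], [k] are unchanged because [M], [Y], [N]
    kill [vbar]. *)
Lemma ext_equiv_coboundary al De x f1 f2 g h k p : f1 = f2 + coboundary al De x p ->
  ext_equiv al De x (ExtData f1 g h k) (ExtData f2 g h k).
Proof.
move=> ->; exists (fun w : Emod R => (w.1 + w.2 * p, w.2)); split.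
- split=> [[a b] [a' b']|c [a b]]; apply: injective_projections => //=; first by ring.
  by rewrite -!mul_polyC; ring.
- by move=> [a b]; apply: injective_projections => //=; ring.
- case=> l [a b]; apply: injective_projections => //=;
    rewrite /dshift /lev ?hornerD ?horner_coboundary ?simpE; ring.
- by move=> a; rewrite /= mul0r addr0.
- by [].
Qed.

(** A splitting is determined by its value [(p, 1)] on [v]; compatibility with [N] gives [k = 0],
    with [L] the coboundary of [p]. *)
Lemma ext_trivial_coboundary al De x f k : ext_trivial al De x (ExtData f 0 0 k) ->
  k = 0 /\ exists p, f = coboundary al De x p.
Proof.
case=> phi [[phiD phiZ] phid phiact phi0 phi2].
pose p := (phi (0, 1)).1.
have phi1 : phi (0, 1) = (p, 1) by rewrite [LHS]surjective_pairing phi2.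
have phiE (q : {poly C}) (c : C) : phi (q, 'X + c%:P) = (q + ('X + c%:P) * p, 'X + c%:P).
  have -> : (q, 'X + c%:P) = (q, 0) + (dmul (0, 1) + c *: (0, 1)) :> Emod R.
    by apply: injective_projections => /=; rewrite -?mul_polyC; ring.
  rewrite !phiD phi0 phid phiZ phi1.
  by apply: injective_projections => /=; rewrite -?mul_polyC; ring.
split.
  apply: eq_poly_horner => l; have := congr1 fst (phiact GN l (0, 1)).
  rewrite phi1 /= /dshift /lev !simpE mul1r phi0 /= => ->; ring.
exists p; apply: eq_poly_horner => l; have := congr1 fst (phiact GL l (0, 1)).
rewrite phi1 /= /dshift /lev !simpE !mul1r mul0r add0r phiE /= horner_coboundary => e.
by apply: (eq_subr_comb (c := 1) e); ring.
Qed.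

End Extensions.

(** * Assembly of the classification *)

Theorem theorem5p9 (R : realType) (alpha Delta Dbar : R[i]) :
  Delta != 0 -> Dbar != 0 ->
  (* every nontrivial extension of this form: Delta - Dbar in {0,...,6} and it is
     equivalent to one in the list, with g = h = 0 *)
  (forall D : ext_data R,
     is_conformal_ext alpha Delta Dbar D ->
     ~ ext_trivial alpha Delta Dbar D ->
     (exists n : nat, (n <= 6)%N /\ Delta - Dbar = n%:R) /\
     exists f k : {poly {poly R[i]}},
       listed_ext alpha Delta Dbar f k /\
       ext_equiv alpha Delta Dbar D (ExtData f 0 0 k))
  /\
  (* every entry of the list is a nontrivial extension *)
  (forall f k : {poly {poly R[i]}},
     listed_ext alpha Delta Dbar f k ->
     is_conformal_ext alpha Delta Dbar (ExtData f 0 0 k) /\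
     ~ ext_trivial alpha Delta Dbar (ExtData f 0 0 k)).
Proof.
move=> _ x0; split.
  case=> f g h k /conformal_ext_cocycles /= [cf ck -> ->] nt.
  have /= cF := L_cocycle_transl (- alpha) cf; have /= ck' := N_cocycle_transl (- alpha) ck.
  rewrite subrr in cF ck'.
  set F := transl _ f in cF; set k0 := transl _ k in ck'.
  have fE : f = transl alpha F by rewrite /F -{1}[alpha]opprK translK.
  have kE : k = transl alpha k0 by rewrite /k0 -{1}[alpha]opprK translK.
  (* Removing a coboundary and translating back gives an equivalent extension, so nontriviality
     excludes [G = k0 = 0]. *)
  have nz G p : F = G + coboundary 0 Delta Dbar p ->
      ~ (G = 0 /\ k0 = 0) /\
      ext_equiv alpha Delta Dbar (ExtData f 0 0 k)
        (ExtData (transl alpha G) 0 0 (transl alpha k0)).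
    move=> FE.
    have eq : ext_equiv alpha Delta Dbar (ExtData f 0 0 k)
        (ExtData (transl alpha G) 0 0 (transl alpha k0)).
      rewrite -kE; apply: (@ext_equiv_coboundary _ _ _ _ _ _ _ _ _ (p \Po ('X + alpha%:P))).
      by rewrite fE FE /transl rmorphD /= -/(transl _ _) -/(transl _ _) transl_coboundary add0r.
    split=> // -[G0 k00]; apply: nt; move: eq; rewrite G0 k00.
    by have -> : transl alpha 0 = 0 :> {poly {poly R[i]}} by rewrite /transl rmorph0.
  (* If [Delta - Dbar] is not a natural number, [f] is a coboundary and [k = 0]. *)
  have [[r eD]|nr] := pselect (exists r : nat, Delta = Dbar + r%:R); last first.
    have ne r : Delta != Dbar + r%:R by apply/eqP => e; apply: nr; exists r.
    have [p FE] := L_classify_generic x0 ne cF.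
    have [[]] := nz 0 p (etrans FE (esym (add0r _))).
    split=> //; apply/polyP => i; apply/polyP => s; rewrite !coef0.
    exact: (N_euler ck').
  rewrite eD in cF ck' nz *.
  have [p [G [FE hG]]] := L_classify x0 cF.
  have hk := N_classify x0 ck'.
  have [{}nz eq] := nz _ _ FE.
  suff [r6 hl] : (r <= 6)%N /\
      listed_ext alpha (Dbar + r%:R) Dbar (transl alpha G) (transl alpha k0).
    split; first by exists r; split=> //; ring.
    by exists (transl alpha G), (transl alpha k0).
  rewrite /listed_ext /= /lam /dbar /cst.
  move: r G k0 {F cF ck' FE fE kE eq eD} hG hk nz => [|[|[|[|[|[|[|r]]]]]]] G k0.
  - move=> [c0 [c1 ->]] [a0 ->] nz; split=> //; left; rewrite addr0; split=> //.
    exists c0, c1, a0; rewrite transl_L_sol0 transl_N_sol0; split; last (split; reflexivity).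
    by apply/negP => /eqP [e0 e1 ea]; apply: nz; rewrite e0 e1 ea L_sol0_0 !polyC0.
  - move=> -> [c ->] nz; split=> //; right; left; split; first by ring.
    exists c; rewrite transl_N_sol1 /transl rmorph0; split; last (split; reflexivity).
    by apply/negP => /eqP e; apply: nz; rewrite e N_sol1_0.
  - move=> [c ->] [a ->] nz; split=> //; do 2 right; left; split; first by ring.
    exists c, a; rewrite -L_sol2_transl -N_sol2_transl; split; last (split; reflexivity).
    by apply/negP => /eqP [e ea]; apply: nz; rewrite e ea N_sol2_0 L_sol2_0.
  - move=> [c ->] hk nz; split=> //; do 3 right.
    have [ex|nx] := eqVneq Dbar (- 2%:R).
      left; split; first by rewrite ex; split=> //; ring.
      have [a ak] : exists a, k0 = N_sol3 0 a.
        by case: hk => [->|[_ //]]; exists 0; rewrite N_sol3_0.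
      exists c, a; rewrite ak -L_sol3_transl -N_sol3_transl; split; last (split; reflexivity).
      by apply/negP => /eqP [e ea]; apply: nz; rewrite ak e ea N_sol3_0 L_sol3_0.
    have {}hk : k0 = 0 by case: hk => [//|[/eqP]]; rewrite (negPf nx).
    right; left; split; first by split=> //; ring.
    exists c; rewrite hk -L_sol3_transl /transl rmorph0; split; last (split; reflexivity).
    by apply/negP => /eqP e; apply: nz; rewrite e hk L_sol3_0.
  - move=> [c ->] hk nz; split=> //; do 5 right; left; split; first by ring.
    exists c; rewrite hk -L_sol4_transl /transl rmorph0; split; last (split; reflexivity).
    by apply/negP => /eqP e; apply: nz; rewrite e hk L_sol4_0.
  - move=> [->|[ex [c ->]]] hk nz; first by case: nz.
    split=> //; do 6 right; left; split; first by rewrite ex; split=> //; ring.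
    exists c; rewrite hk -L_sol5_transl /transl rmorph0; split; last (split; reflexivity).
    by apply/negP => /eqP e; apply: nz; rewrite e hk L_sol5_0.
  - move=> [->|[ex [c ->]]] hk nz; first by case: nz.
    split=> //; do 7 right; split; first exact: quadratic_sqrt19.
    exists c; rewrite hk -L_sol6_transl /transl rmorph0; split; last (split; reflexivity).
    by apply/negP => /eqP e; apply: nz; rewrite e hk L_sol6_0.
  - by move=> -> -> [].
(* Conversely, triviality would make [k = 0] and [f] a coboundary, hence all parameters 0. *)
move=> f k; rewrite /listed_ext /= /lam /dbar /cst.
have conf := cocycles_conformal_ext.
have DE n : Delta - Dbar = n -> Delta = Dbar + n by move=> <-; ring.
case=> [[-> [c0 [c1 [a0 [nz [-> ->]]]]]]|].
  split; first exact: conf (L_sol0_cocycle _ _ _ _) (N_sol0_cocycle _ _ _).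
  move=> /ext_trivial_coboundary [/eqP k0 [p /L_sol0_coboundary [c00 c10]]].
  by move: k0 nz; rewrite c00 c10 !polyC_eq0 => /eqP ->; rewrite eqxx.
case=> [[/DE -> [a1 [nz [-> ->]]]]|].
  split; first exact: conf (L_cocycle0 _ _ _) (N_sol1_cocycle _ _ _).
  by move=> /ext_trivial_coboundary [/eqP]; rewrite mulf_eq0 polyX_eq0 orbF !polyC_eq0 (negPf nz).
case=> [[/DE -> [c2 [a2 [nz [-> ->]]]]]|].
  split; first exact: conf (L_sol2_cocycle _ _ _) (N_sol2_cocycle _ _ _).
  move=> /ext_trivial_coboundary [k0 [p /L_sol2_coboundary c0]].
  have := congr1 (transl (- alpha)) (k0 : N_sol2 alpha Dbar a2 = 0).
  rewrite N_sol2_transl translK N_sol2_low /transl rmorph0.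
  move=> /(congr1 (fun P : {poly {poly R[i]}} => P`_1`_1)).
  by rewrite coef_low1 coef_monomial !coef0 => a0; rewrite c0 a0 eqxx in nz.
case=> [[[-> ->] [c3 [a3 [nz [-> ->]]]]]|].
  have D1 : - 2%:R + 3%:R = 1 :> R[i] by ring.
  have cL := L_sol3_cocycle alpha (- 2%:R) c3; rewrite D1 in cL.
  split; first exact: conf cL (N_sol3_cocycle _ _).
  move=> /ext_trivial_coboundary [k0 [p /L_sol3_coboundary c0]].
  have := congr1 (transl (- alpha)) (k0 : N_sol3 alpha a3 = 0).
  rewrite N_sol3_transl translK N_sol3_low /transl rmorph0.
  move=> /(congr1 (fun P : {poly {poly R[i]}} => P`_1`_2)).
  by rewrite coef_low1 coef_monomial !coef0 => a0; rewrite c0 a0 eqxx in nz.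
case=> [[[/DE -> _] [c3 [nz [-> ->]]]]|].
  split; first exact: conf (L_sol3_cocycle _ _ _) (N_cocycle0 _ _ _).
  by move=> /ext_trivial_coboundary [_ [p /L_sol3_coboundary c0]]; rewrite c0 eqxx in nz.
case=> [[/DE -> [c5 [nz [-> ->]]]]|].
  split; first exact: conf (L_sol4_cocycle _ _ _) (N_cocycle0 _ _ _).
  by move=> /ext_trivial_coboundary [_ [p /L_sol4_coboundary c0]]; rewrite c0 eqxx in nz.
case=> [[[-> ->] [c6 [nz [-> ->]]]]|].
  split; first exact: conf (L_sol5_cocycle _ _) (N_cocycle0 _ _ _).
  by move=> /ext_trivial_coboundary [_ [p /L_sol5_coboundary c0]]; rewrite c0 eqxx in nz.
case=> [[s [s19 [De xE]]] [c7 [nz [-> ->]]]].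
have ex := sqrt19_quadratic s19 xE.
have -> : Delta = Dbar + 6%:R by rewrite De xE; field.
split; first exact: conf (L_sol6_cocycle _ _ ex) (N_cocycle0 _ _ _).
move=> /ext_trivial_coboundary [_ [p /L_sol6_coboundary c0]].
by rewrite c0 ?eqxx // in nz; apply: quadratic_not_root.
Qed.
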